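(* Let $\mathcal M \subseteq \mathcal B(\mathcal H)$ and $\mathcal N \subseteq \mathcal B(\mathcal K)$ be von Neumann algebras. For a normal unital $*$-homomorphism $\pi : \mathcal N \to \mathcal M$ put $$\mathfrak G(\pi) = \{ v \in \mathcal B(\mathcal H, \mathcal K) \mid b v = v\pi(b) \text{ for all } b \in \mathcal N\}.$$ Then $\pi \mapsto \mathfrak G(\pi)$ is a bijection from the set of normal unital $*$-homomorphisms $\mathcal N \to \mathcal M$ onto the set of quantum functions from $\mathcal M$ to $\mathcal N$. Moreover, this correspondence is (contravariantly) functorial: for every von Neumann algebra $\mathcal M \subseteq \mathcal B(\mathcal H)$ the identity $*$-homomorphism $\iota:\mathcal M \to \mathcal M$ satisfies $\mathfrak G(\iota) = \mathcal M'$, and for all von Neumann algebras $\mathcal M_0, \mathcal M_1, \mathcal M_2$ (each given concretely on a Hilbert space) and all normal unital $*$-homomorphisms $\pi_1 : \mathcal M_2 \to \mathcal M_1$ and $\pi_0 : \mathcal M_1 \to \mathcal M_0$, one has $\mathfrak G(\pi_0 \circ \pi_1) = \mathfrak G(\pi_1)\mathfrak G(\pi_0)$.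
   Context: Von Neumann algebras are concrete: $\mathcal M\subseteq \mathcal B(\mathcal H)$ contains the identity operator of $\mathcal H$, and $\mathcal M'$ is its commutant in $\mathcal B(\mathcal H)$. $\mathcal B(\mathcal H,\mathcal K)$ is the space of bounded operators $\mathcal H\to\mathcal K$. For a subspace $\mathcal V\subseteq\mathcal B(\mathcal H,\mathcal K)$, $\mathcal V^* = \{v^* \mid v\in\mathcal V\}\subseteq \mathcal B(\mathcal K,\mathcal H)$. For ultraweakly closed subspaces $\mathcal V, \mathcal W$ of composable operators, $\mathcal V\mathcal W$ denotes the ultraweak closure of $\mathrm{span}\{vw \mid v\in\mathcal V, w\in\mathcal W\}$. A quantum relation between $\mathcal M \subseteq \mathcal B(\mathcal H)$ and $\mathcal N \subseteq \mathcal B(\mathcal K)$ is an ultraweakly closed subspace $\mathcal V \subseteq \mathcal B(\mathcal H,\mathcal K)$ such that $\mathcal N'\mathcal V\mathcal M' \subseteq \mathcal V$. A quantum function from $\mathcal M$ to $\mathcal N$ is a quantum relation $\mathcal V$ between $\mathcal M$ and $\mathcal N$ such that $\mathcal M' \subseteq \mathcal V^*\mathcal V$ and $\mathcal V\mathcal V^* \subseteq \mathcal N'$. The composition of $\mathcal V_0$ (from $\mathcal M_0$ to $\mathcal M_1$) with $\mathcal V_1$ (from $\mathcal M_1$ to $\mathcal M_2$) is $\mathcal V_1\mathcal V_0$, and the identity quantum function on $\mathcal M$ is $\mathcal M'$. *)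

(* Defs.v *)
From HB Require Import structures.
From mathcomp Require Import all_boot all_order all_algebra sesquilinear.
From mathcomp Require Import complex.
From mathcomp Require Import all_classical all_reals all_analysis.

Set Implicit Arguments.
Unset Strict Implicit.
Unset Printing Implicit Defensive.

Import Order.TTheory GRing.Theory Num.Theory.
Import numFieldNormedType.Exports.

Local Open Scope classical_set_scope.
Local Open Scope ring_scope.

(* R[i] seen as an element of numClosedFieldType, so that it inherits the
   metric topology of a numeric field. *)
Definition cplx (R : realType) : numClosedFieldType := R[i]%C.

(* The inner product is linear in its first argument and conjugate-linear in
   the second one. The zero space is allowed. *)
HB.mixin Record isHilbert (R : realType) H
    of CompleteNormedModule (cplx R) H := {
  hdot : {dot H for (@Num.conj (cplx R))} ;
  hdot_normE : forall x : H, hdot x x = `|x| ^+ 2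
}.

#[short(type="hilbertType")]
HB.structure Definition Hilbert (R : realType) :=
  {H of isHilbert R H & CompleteNormedModule (cplx R) H}.

Section BoundedOperators.
Context {R : realType}.

Definition bounded_op {H K : hilbertType R} : {pred H -> K} :=
  fun f => `[< linear f /\ exists c, forall x, `|f x| <= c * `|x| >].

Record bop (H K : hilbertType R) :=
  Bop { bop_fun :> H -> K ; bopP : bop_fun \in bounded_op }.

HB.instance Definition _ H K := [isSub for @bop_fun H K].
HB.instance Definition _ H K := [Choice of bop H K by <:].

Lemma bounded_op_submod (H K : hilbertType R) :
  submod_closed (@bounded_op H K).
Proof.
split=> [|a f g /asboolP[lf [c fc]] /asboolP[lg [d gd]]]; apply/asboolP; split.
- by move=> k x y; rewrite /= scaler0 addr0.
- by exists 0 => x; rewrite normr0 mul0r.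
- move=> k x y; rewrite /= !fctE lf lg !scalerDr !scalerA mulrC -!addrA.
  by congr (_ + _); rewrite addrCA.
- exists (`|a| * c + d) => x; rewrite mulrDl -mulrA.
  rewrite (le_trans (ler_normD _ _))// lerD// normrZ.
  by rewrite ler_wpM2l.
Qed.

HB.instance Definition _ H K :=
  GRing.isSubmodClosed.Build _ _ (@bounded_op H K) (@bounded_op_submod H K).
HB.instance Definition _ H K := [SubChoice_isSubLmodule of bop H K by <:].

Lemma bounded_op_id (H : hilbertType R) : @idfun H \in bounded_op.
Proof. by apply/asboolP; split=> //; exists 1 => x; rewrite mul1r. Qed.

Definition bop1 (H : hilbertType R) : bop H H := Bop (bounded_op_id H).

Lemma bounded_op_comp (H K L : hilbertType R) (v : bop K L) (w : bop H K) :
  v \o w \in bounded_op.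
Proof.
have /asboolP[lv [c vc]] := bopP v; have /asboolP[lw [d wd]] := bopP w.
apply/asboolP; split=> [k x y|]; first by rewrite /= lw lv.
exists (`|c| * d) => x /=; rewrite -mulrA (le_trans (vc _))//.
rewrite -(ger0_norm (le_trans (normr_ge0 _) (vc (w x)))) normrM normr_id.
by rewrite ler_wpM2l.
Qed.

Definition bop_comp (H K L : hilbertType R) (v : bop K L) (w : bop H K) :
  bop H L := Bop (bounded_op_comp v w).

(* By the Riesz representation theorem, every v has exactly one adjoint w. *)
Definition adjoint (H K : hilbertType R) (v : bop H K) (w : bop K H) :=
  forall x y, hdot (v x) y = hdot x (w y).

End BoundedOperators.

Infix "\oB" := bop_comp (at level 40, left associativity).

Section Ultraweak.
Context {R : realType}.

Definition square_summable (H : hilbertType R) (xi : nat -> H) : Prop :=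
  cvgn (series (fun n => `|xi n| ^+ 2 : cplx R)).

Definition l2pair (H K : hilbertType R) : Type :=
  {p : (nat -> H) * (nat -> K) | square_summable p.1 /\ square_summable p.2}.

Definition ultraweak_functional (H K : hilbertType R) (v : bop H K)
    (p : l2pair H K) : cplx R :=
  limn (series (fun n => hdot (v ((sval p).1 n)) ((sval p).2 n) : cplx R)).

(* The topology of [bop H K] is the ultraweak one: the coarsest topology making
   v |-> \sum_n <v (xi n), eta n> continuous for all square-summable xi, eta. *)
HB.instance Definition _ (H K : hilbertType R) :=
  Topological.copy (bop H K)
    (@initial_topology (bop H K) (prod_topology (fun _ : l2pair H K => cplx R))
       (@ultraweak_functional H K)).

End Ultraweak.

Section VonNeumann.
Context {R : realType}.

Definition subspace_op (H K : hilbertType R) (V : set (bop H K)) : Prop :=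
  submod_closed [in V].

Definition commutant (H : hilbertType R) (M : set (bop H H)) : set (bop H H) :=
  [set a | forall m, M m -> a \oB m = m \oB a].

Definition adjoint_set (H K : hilbertType R) (V : set (bop H K)) :
  set (bop K H) := [set w | exists2 v, V v & adjoint v w].

Definition prod_op (H K L : hilbertType R) (V : set (bop K L))
    (W : set (bop H K)) : set (bop H L) :=
  closure (smallest (@subspace_op H L) [set v \oB w | v in V & w in W]).

Record von_neumann (H : hilbertType R) (M : set (bop H H)) : Prop := {
  vn_subspace : subspace_op M ;
  vn_unit : M (bop1 H) ;
  vn_comp : forall a b, M a -> M b -> M (a \oB b) ;
  vn_adjoint : adjoint_set M `<=` M ;
  vn_closed : closed M
}.

Record quantum_relation (H K : hilbertType R) (M : set (bop H H))
    (N : set (bop K K)) (V : set (bop H K)) : Prop := {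
  qrel_subspace : subspace_op V ;
  qrel_closed : closed V ;
  qrel_bimodule : prod_op (prod_op (commutant N) V) (commutant M) `<=` V
}.

Record quantum_function (H K : hilbertType R) (M : set (bop H H))
    (N : set (bop K K)) (V : set (bop H K)) : Prop := {
  qfun_relation : quantum_relation M N V ;
  qfun_total : commutant M `<=` prod_op (adjoint_set V) V ;
  qfun_functional : prod_op V (adjoint_set V) `<=` commutant N
}.

(* Normal unital *-homomorphisms N -> M. Here N and M are regarded as types,
   with the subspace topologies, and the algebraic operations on them are those
   of the ambient operators. Normality is ultraweak continuity. *)
Record normal_hom (H K : hilbertType R) (N : set (bop K K))
    (M : set (bop H H)) (pi : N -> M) : Prop := {
  hom_linear : forall (c : cplx R) (a b d : N),
    set_val d = c *: set_val a + set_val b ->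
    set_val (pi d) = c *: set_val (pi a) + set_val (pi b) ;
  hom_mul : forall a b d : N, set_val d = set_val a \oB set_val b ->
    set_val (pi d) = set_val (pi a) \oB set_val (pi b) ;
  hom_unit : forall a : N, set_val a = bop1 K -> set_val (pi a) = bop1 H ;
  hom_adjoint : forall a b : N, adjoint (set_val a) (set_val b) ->
    adjoint (set_val (pi a)) (set_val (pi b)) ;
  hom_normal : continuous pi
}.

Definition graph (H K : hilbertType R) (N : set (bop K K))
    (M : set (bop H H)) (pi : N -> M) : set (bop H K) :=
  [set v | forall b : N, set_val b \oB v = v \oB set_val (pi b)].

End VonNeumann.

(* Main.v *)
Require Import Defs.
From HB Require Import structures.
From mathcomp Require Import all_boot all_order all_algebra sesquilinear.
From mathcomp Require Import complex.
From mathcomp Require Import all_classical all_reals all_analysis.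
From mathcomp Require Import ring lra.

Set Implicit Arguments.
Unset Strict Implicit.
Unset Printing Implicit Defensive.

Import Order.TTheory GRing.Theory Num.Theory.
Import numFieldNormedType.Exports.

Local Open Scope classical_set_scope.
Local Open Scope ring_scope.

(** Write [V] for the graph of a normal unital homomorphism [pi]: the operators
    [v] with [b v = v pi(b)].  Half of the axioms of a quantum function are
    formal, for instance [b v adj(w) = v pi(b) adj(w) = v adj(w) b] puts
    [V adj(V)] into the commutant of [N].  The analytic content is that a normal
    homomorphism has enough intertwiners, and that the homomorphism constructed
    from a quantum function is normal.  Both are settled in the Hilbert space
    [l2 K] of square-summable sequences, on which [b] acts coordinatewise as
    [amp b], since the ultraweakly continuous linear functionals are exactly the
    maps [b |-> <amp b x, y>] with [x], [y] in [l2].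

    Duality.  Ultraweak closures are computed by these functionals: the closure
    of a subspace is its bipolar ([closure_bipolar]), so that an inclusion
    between closed spans of products is tested on functionals vanishing on the
    products ([prod_opP]).  Operators are produced by one minimisation argument:
    a bounded linear relation has an adjoint ([bounded_rel_adjoint]).

    Enough intertwiners ([intertwiners_nondegenerate]).  Given a vector [h],
    normality writes [<pi(b) h, h>] as [<amp b x, y>], and polarisation gives
    [|pi(b) h| <= |amp b z|] for [z = x + y].  Hence [amp b z |-> pi(b) h] is
    bounded; its adjoint is an intertwiner from [H] to [l2 K] that does not kill
    [h] unless [h = 0], and its coordinates belong to [V].  So [V] has no common
    kernel, and [pi] can be recovered from [V].  Moreover [adj(V) V] spans a
    selfadjoint algebra without common kernel, so the bicommutant theorem
    ([bicommutant_closure]) puts the identity into its closure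
    ([one_in_prod_op]).  Multiplying by elements of the commutant of [M] shows
    that [V] is a quantum function, and writing [u = u 1] gives functoriality.

    From [V] to [pi].  The rule [v pi(b) = b v] forces [pi(b)] to map
    [\sum_i adj(v_i) k_i] to [\sum_i adj(v_i) b k_i]; because [V adj(V)]
    commutes with [N], powers of [b adj(b)] can be moved across inner products,
    and comparing growth rates bounds this map ([moment_growth],
    [intertwined_exists]).  The operator [pi(b)] commutes with the commutant of
    [M], so it lies in [M].  For normality one needs, for each vector [x], some
    [z] in [l2 K] with [|pi(b) x|^2 <= 2 |amp b z|^2] ([domination]): replace [x]
    repeatedly by [x - adj(W) W x] for contractive intertwiners [W] from [H] to
    [l2 K], and let [z] record the vectors [W x].  Applied in [l2 H], this
    expresses [<amp (pi b) x, y>] through [amp b z]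
    ([normal_of_nondegenerate]). *)

(** * Inner products in real form *)

(** The real part of the inner product carries the whole geometry, and turns every
    estimate into one over the ordered field [R].  It is sealed so that real
    arithmetic treats it as an atom. *)
HB.lock Definition rdot (R : realType) (H : hilbertType R) (x y : H) : R :=
  complex.Re (hdot x y : cplx R).

Section InnerProduct.
Context {R : realType}.
Local Notation C := (cplx R).
Local Notation Re := complex.Re.
Local Notation Im := complex.Im.
Implicit Types (H K L : hilbertType R).

Lemma rdotE H (x y : H) : rdot x y = Re (hdot x y : C).
Proof. by rewrite unlock. Qed.

Lemma ReD (z w : C) : Re (z + w) = Re z + Re w.
Proof. by case: z; case: w. Qed.
Lemma ReN (z : C) : Re (- z) = - Re z.
Proof. by case: z. Qed.
Lemma ReM (z w : C) : Re (z * w) = Re z * Re w - Im z * Im w.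
Proof. by case: z; case: w. Qed.
Lemma ReJ (z : C) : Re (Num.conj z) = Re z.
Proof. by case: z. Qed.

Lemma hdotDl H (x y z : H) : hdot (x + y) z = hdot x z + hdot y z :> C.
Proof. by rewrite linearDl. Qed.
Lemma hdotDr H (x y z : H) : hdot z (x + y) = hdot z x + hdot z y :> C.
Proof. by rewrite linearD. Qed.
Lemma hdotZl H (a : C) (x z : H) : hdot (a *: x) z = a * hdot x z :> C.
Proof. by rewrite linearZl. Qed.
Lemma hdotZr H (a : C) (x z : H) : hdot x (a *: z) = Num.conj a * hdot x z :> C.
Proof. by rewrite linearZ. Qed.
Lemma hdotC H (x z : H) : hdot x z = Num.conj (hdot z x) :> C.
Proof. by rewrite hermC expr0 mul1r. Qed.
Lemma hdot0l H (x : H) : hdot 0 x = 0 :> C.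
Proof. by rewrite linear0l. Qed.
Lemma hdot0r H (x : H) : hdot x 0 = 0 :> C.
Proof. by rewrite linear0. Qed.
Lemma hdotNl H (x y : H) : hdot (- x) y = - hdot x y :> C.
Proof. by rewrite linearNl. Qed.
Lemma hdotNr H (x y : H) : hdot x (- y) = - hdot x y :> C.
Proof. by rewrite linearN. Qed.
Lemma hdotBr H (x y z : H) : hdot z (x - y) = hdot z x - hdot z y :> C.
Proof. by rewrite hdotDr hdotNr. Qed.
Lemma hdot_eq0 H (x : H) : hdot x x = 0 :> C -> x = 0.
Proof.
by rewrite hdot_normE => /eqP; rewrite expf_eq0/= normr_eq0 => /eqP.
Qed.
Lemma hdot_suml H I (s : seq I) (F : I -> H) (y : H) :
  hdot (\sum_(i <- s) F i) y = \sum_(i <- s) (hdot (F i) y : C).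
Proof.
elim: s => [|i s IH]; first by rewrite !big_nil hdot0l.
by rewrite !big_cons hdotDl IH.
Qed.

Lemma hdot_inj H (x y : H) : (forall z, hdot z x = hdot z y :> C) -> x = y.
Proof.
by move=> xy; apply/eqP; rewrite -subr_eq0; apply/eqP/hdot_eq0;
  rewrite hdotBr xy subrr.
Qed.

Definition normsq H (x : H) : R := rdot x x.

Lemma normsqE H (x : H) : `|x| ^+ 2 = (normsq x)%:C%C.
Proof.
by rewrite -hdot_normE /normsq !rdotE RRe_real// hdot_normE ger0_real// exprn_ge0.
Qed.
Lemma hdot_normsq H (x : H) : hdot x x = (normsq x)%:C%C :> C.
Proof. by rewrite -normsqE hdot_normE. Qed.

Lemma rdotC H (x y : H) : rdot x y = rdot y x.
Proof. by rewrite !rdotE hdotC ReJ. Qed.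
Lemma rdotDl H (x y z : H) : rdot (x + y) z = rdot x z + rdot y z.
Proof. by rewrite !rdotE hdotDl ReD. Qed.
Lemma rdotDr H (x y z : H) : rdot z (x + y) = rdot z x + rdot z y.
Proof. by rewrite !rdotE hdotDr ReD. Qed.
Lemma rdotNl H (x y : H) : rdot (- x) y = - rdot x y.
Proof. by rewrite !rdotE hdotNl ReN. Qed.
Lemma rdotNr H (x y : H) : rdot x (- y) = - rdot x y.
Proof. by rewrite !rdotE hdotNr ReN. Qed.
Lemma rdotBr H (x y z : H) : rdot z (x - y) = rdot z x - rdot z y.
Proof. by rewrite rdotDr rdotNr. Qed.
Lemma rdot0l H (x : H) : rdot 0 x = 0.
Proof. by rewrite !rdotE hdot0l. Qed.
Lemma rdot0r H (x : H) : rdot x 0 = 0.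
Proof. by rewrite !rdotE hdot0r. Qed.
Lemma rdotZl H (r : R) (x y : H) : rdot ((r%:C%C : C) *: x) y = r * rdot x y.
Proof. by rewrite !rdotE hdotZl ReM/= mul0r subr0. Qed.
Lemma rdotZr H (r : R) (x y : H) : rdot x ((r%:C%C : C) *: y) = r * rdot x y.
Proof. by rewrite rdotC rdotZl rdotC. Qed.

(** The real part determines the inner product, because [Im z] is the real part of
    [- i z]. *)
Lemma hdotE H (x y : H) : hdot x y =
  Complex (rdot x y) (rdot (- ('i%C : C) *: x) y) :> C.
Proof.
rewrite !rdotE hdotZl mulNr ReN ReM /= mul0r sub0r mul1r opprK.
by case: (hdot x y : C).
Qed.

Lemma normsq0 H : normsq (0 : H) = 0. Proof. exact: rdot0l. Qed.
Lemma normsqN H (x : H) : normsq (- x) = normsq x.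
Proof. by rewrite /normsq rdotNl rdotNr opprK. Qed.
Lemma normsqD H (x y : H) : normsq (x + y) = normsq x + 2 * rdot x y + normsq y.
Proof. rewrite /normsq !rdotDl !rdotDr (rdotC y x); ring. Qed.
Lemma normsqB H (x y : H) : normsq (x - y) = normsq x - 2 * rdot x y + normsq y.
Proof. rewrite normsqD rdotNr normsqN; ring. Qed.
Lemma normsqZ H (a : C) (x : H) : normsq (a *: x) = (Re a ^+ 2 + Im a ^+ 2) * normsq x.
Proof.
rewrite /normsq !rdotE hdotZl hdotZr mulrA hdot_normsq; case: a => a b.
rewrite ReM /= mulr0 subr0; congr (_ * _); ring.
Qed.
Lemma normsqZr H (r : R) (x : H) : normsq ((r%:C%C : C) *: x) = r ^+ 2 * normsq x.
Proof. by rewrite normsqZ /= expr0n addr0. Qed.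
Lemma normsq_ge0 H (x : H) : 0 <= normsq x.
Proof. by rewrite -lecR -normsqE exprn_ge0. Qed.
Lemma normsq_eq0 H (x : H) : normsq x = 0 -> x = 0.
Proof. by move=> x0; apply: hdot_eq0; rewrite hdot_normsq x0. Qed.

Lemma rdot_AMGM H (x y : H) : 2 * rdot x y <= normsq x + normsq y.
Proof. have := normsq_ge0 (x - y); rewrite normsqB; lra. Qed.

(** Positivity of the square norm of [<y, y> x - Re <x, y> y]. *)
Lemma rdot_CS H (x y : H) : rdot x y ^+ 2 <= normsq x * normsq y.
Proof.
have := normsq_ge0 (((normsq y)%:C%C : C) *: x - ((rdot x y)%:C%C : C) *: y).
rewrite normsqB !normsqZr rdotZl rdotZr => h.
have [y0|yn0] := eqVneq (normsq y) 0.
  by move/normsq_eq0: y0 => ->; rewrite rdot0r normsq0 mulr0 expr0n.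
have y0 : 0 < normsq y by rewrite lt0r yn0 normsq_ge0.
rewrite -subr_ge0 -(pmulr_rge0 _ y0); apply: le_trans h _; nra.
Qed.

Lemma normsqD_le H (x y : H) : normsq (x + y) <= 2 * normsq x + 2 * normsq y.
Proof. have := rdot_AMGM x y; rewrite normsqD; lra. Qed.
Lemma normsqB_le H (x y : H) : normsq (x - y) <= 2 * normsq x + 2 * normsq y.
Proof. by have := normsqD_le x (- y); rewrite normsqN. Qed.

Lemma normr_lt_normsq H (x : H) (e : R) : 0 < e ->
  (`|x| < (e%:C%C : C)) = (normsq x < e ^+ 2).
Proof.
move=> e0.
rewrite -(@ltr_pXn2r C 2)//; last by rewrite nnegrE ler0c ltW.
by rewrite normsqE -rmorphXn ltcR.
by rewrite nnegrE.
Qed.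

Lemma bop_linear_subproof H K (v : bop H K) : linear (v : H -> K).
Proof. by have /asboolP[] := bopP v. Qed.
HB.instance Definition _ H K (v : bop H K) :=
  GRing.isLinear.Build C H K *:%R (bop_fun v) (bop_linear_subproof v).

Lemma bopE H K (v w : bop H K) : v =1 w -> v = w.
Proof. by move=> vw; apply/val_inj/funext. Qed.

Lemma gtc0_real (e : C) : 0 < e -> exists2 r : R, 0 < r & e = r%:C%C.
Proof.
case: e => a b; rewrite ltcE /= => /andP[/eqP b0 a0]; exists a => //.
by rewrite b0.
Qed.
Lemma gec0_real (e : C) : 0 <= e -> exists2 r : R, 0 <= r & e = r%:C%C.
Proof.
case: e => a b; rewrite lecE /= => /andP[/eqP b0 a0]; exists a => //.
by rewrite b0.
Qed.

Lemma bop_bounded H K (v : bop H K) :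
  exists2 c : R, 0 < c & forall x, normsq (v x) <= c * normsq x.
Proof.
have /asboolP[_ [c vc]] := bopP v.
have [r r0 rE] := gec0_real (normr_ge0 c).
exists (r ^+ 2 + 1) => [|x]; first by rewrite ltr_pwDr// sqr_ge0.
have : `|v x| <= (r%:C%C : C) * `|x|.
  rewrite -rE (le_trans (vc x))// -[X in _ <= _ * X]normr_id -normrM ger0_norm//.
  by rewrite (le_trans _ (vc x)).
move=> vx; have {vx} : `|v x| ^+ 2 <= ((r%:C%C : C) * `|x|) ^+ 2.
  by rewrite lerXn2r// nnegrE ?mulr_ge0// ler0c.
rewrite exprMn !normsqE -rmorphXn -[X in _ <= X](rmorphM (real_complex R)) lecR => h.
rewrite (le_trans h)// ler_wpM2r ?normsq_ge0//; lra.
Qed.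

(** Boundedness is stated with squares throughout, which avoids square roots. *)
Lemma bounded_normsq H K (f : H -> K) (c : R) : linear f -> 0 <= c ->
  (forall x, normsq (f x) <= c * normsq x) -> f \in bounded_op.
Proof.
move=> lf c0 fc; apply/asboolP; split=> //.
exists ((c + 1)%:C%C) => x.
have c1 : 0 <= c + 1 by rewrite addr_ge0.
rewrite -(@ler_pXn2r C 2) ?nnegrE ?mulr_ge0 ?ler0c//.
rewrite exprMn !normsqE -rmorphXn -[X in _ <= X](rmorphM (real_complex R)) lecR.
rewrite (le_trans (fc x))// ler_wpM2r ?normsq_ge0//; nra.
Qed.

Lemma normsq_complete H (u : nat -> H) :
  (forall e : R, 0 < e -> exists N, forall m n, (N <= m)%N -> (N <= n)%N ->
     normsq (u m - u n) < e) ->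
  exists l, forall e : R, 0 < e -> exists N, forall n, (N <= n)%N -> normsq (l - u n) < e.
Proof.
move=> uC.
have : cvgn u.
  apply: cauchy_cvg; apply: cauchy_exP => e /gtc0_real[r r0 ->].
  have [N uN] := uC _ (exprn_gt0 2 r0).
  exists (u N); exists N => //= n Nn.
  by rewrite -ball_normE /= normr_lt_normsq//; exact: uN.
move=> /cvg_ex[l ul]; exists l => e e0.
move/cvgrPdist_lt: ul => /(_ (Num.sqrt e)%:C%C).
rewrite ltcR sqrtr_gt0 => /(_ e0)[N _ uN]; exists N => n Nn.
have := uN n Nn; rewrite /= normr_lt_normsq ?sqrtr_gt0// sqr_sqrtr//.
exact: ltW.
Qed.

End InnerProduct.

(** * The Riesz theorem for bounded relations *)

Section Riesz.
Context {R : realType}.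
Local Notation C := (cplx R).
Local Notation Re := complex.Re.
Local Notation Im := complex.Im.
Implicit Types (H K L : hilbertType R).

Definition rel_subspace H K (S : set (H * K)) : Prop :=
  [/\ S (0, 0) & forall (a : C) p q, S p -> S q ->
        S (a *: p.1 + q.1, a *: p.2 + q.2)].

Lemma invnS_small (e : R) : 0 < e -> exists N, forall n, (N <= n)%N -> n.+1%:R^-1 < e.
Proof.
move=> e0; exists (Num.truncn e^-1) => n Nn.
rewrite invf_plt ?posrE// (lt_le_trans (truncnS_gt _))// ler_nat//.
Qed.

(** Minimise [|h|^2 - 2 Re <k, y>] over the pairs [(h, k)] of [S].  A minimising
    sequence is Cauchy by the parallelogram identity, and the first-order condition
    at its limit [z] says that [h |-> <k, y>] is represented by [z].  Adjoints,
    orthogonal projections and extensions of bounded maps are all instances. *)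
Lemma riesz_relation H K (S : set (H * K)) (c : R) (y : K) :
  rel_subspace S -> (forall p, S p -> normsq p.2 <= c * normsq p.1) -> 0 < c ->
  exists z : H, (forall p, S p -> hdot p.1 z = hdot p.2 y :> C) /\
    forall e : R, 0 < e -> exists2 p, S p & normsq (z - p.1) < e.
Proof.
move=> [S0 Sl] Sc c0.
have Szr (r : R) p : S p -> S ((r%:C%C : C) *: p.1, (r%:C%C : C) *: p.2).
  by move=> Sp; have := Sl r%:C%C p _ Sp S0; rewrite /= !addr0.
have SD p q : S p -> S q -> S (p.1 + q.1, p.2 + q.2).
  by move=> Sp Sq; have := Sl 1 p q Sp Sq; rewrite !scale1r.
pose J (p : H * K) := normsq p.1 - 2 * rdot p.2 y.
have J_ge p : S p -> - (c * normsq y) <= J p.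
  move=> Sp; have := normsq_ge0 (((c^-1)%:C%C : C) *: p.2 - y).
  rewrite normsqB normsqZr rdotZl => h.
  have : 0 <= c * (c^-1 ^+ 2 * normsq p.2 - 2 * (c^-1 * rdot p.2 y) + normsq y).
    by rewrite mulr_ge0// ltW.
  have -> : c * (c^-1 ^+ 2 * normsq p.2 - 2 * (c^-1 * rdot p.2 y) + normsq y) =
     c^-1 * normsq p.2 - 2 * rdot p.2 y + c * normsq y by field; exact: lt0r_neq0.
  have : c^-1 * normsq p.2 <= normsq p.1 by rewrite ler_pdivrMl// Sc.
  rewrite /J; lra.
pose A := [set J p | p in S].
have infA : has_inf A.
  by split; [exists (J (0, 0)), (0, 0)|exists (- (c * normsq y)) => _ [p Sp <-]; exact: J_ge].
have JA p : S p -> inf A <= J p.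
  by move=> Sp; apply: ge_inf; [exact: infA.2|exists p].
have hs n : exists p, S p /\ J p < inf A + n.+1%:R^-1.
  have [|_ [p Sp <-] Jp] := @inf_adherent R A n.+1%:R^-1 _ infA.
    by rewrite invr_gt0.
  by exists p.
have /choice[s sP] := hs.
have nqs m n : normsq ((s m).1 - (s n).1) <= 2 * m.+1%:R^-1 + 2 * n.+1%:R^-1.
  have [[Sm Jm] [Sn Jn]] := (sP m, sP n).
  have := JA _ (Szr (2^-1) _ (SD _ _ Sm Sn)).
  move: Jm Jn; rewrite /J /= normsqZr rdotZl normsqD normsqB rdotDl expr2.
  move: (m.+1%:R^-1) (n.+1%:R^-1) => a b; lra.
have [|z zs] := @normsq_complete _ _ (fst \o s).
  move=> e e0; have [|N Ns] := @invnS_small (e / 4); first by rewrite divr_gt0.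
  exists N => m n /Ns Nm /Ns Nn; rewrite (le_lt_trans (nqs m n))//.
  move: (m.+1%:R^-1) (n.+1%:R^-1) Nm Nn => a b; lra.
have zS (p : H * K) : S p -> rdot p.1 z = rdot p.2 y.
  move=> Sp; pose w := rdot p.1 z - rdot p.2 y.
  have qp := normsq_ge0 p.1; pose q1 : R := 1 + normsq p.1.
  have q10 : 0 < q1 by rewrite /q1; lra.
  have wn n : (rdot p.1 (s n).1 - rdot p.2 y) ^+ 2 <= q1 * n.+1%:R^-1.
    set v := _ - _; have [Sn Jn] := sP n.
    have := JA _ (SD _ _ Sn (Szr (- (v / q1)) _ Sp)).
    (* The step - v / q1 with q1 = 1 + |p.1|^2 shows v^2 / q1 <= 1 / (n + 1). *)
    have -> : J ((s n).1 + ((- (v / q1))%:C%C : C) *: p.1,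
        (s n).2 + ((- (v / q1))%:C%C : C) *: p.2) =
        J (s n) - 2 * (v / q1) * v + (v / q1) ^+ 2 * normsq p.1.
      rewrite /J /= normsqD normsqZr rdotDl rdotZl rdotZr (rdotC _ p.1) /v; ring.
    have -> : normsq p.1 = q1 - 1 by rewrite /q1; ring.
    have -> : J (s n) - 2 * (v / q1) * v + (v / q1) ^+ 2 * (q1 - 1) =
        J (s n) - (v ^+ 2 / q1) - (v / q1) ^+ 2 by field; exact: lt0r_neq0.
    move=> h; rewrite mulrC -ler_pdivrMr//.
    have := sqr_ge0 (v / q1); move: (n.+1%:R^-1) Jn h => a; lra.
  apply/eqP; rewrite -subr_eq0 -/w -sqrf_eq0; apply/eqP.
  apply/eqP; rewrite eq_le sqr_ge0 andbT; apply/ler_addgt0Pl => e e0.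
  have e4 : 0 < e / (4 * q1) by rewrite divr_gt0// mulr_gt0.
  have [N1 h1] := invnS_small e4; have [N2 h2] := zs _ e4.
  pose n := maxn N1 N2; have {}h1 := h1 n (leq_maxl _ _).
  have {}h2 := h2 n (leq_maxr _ _).
  have cs := rdot_CS p.1 (z - (s n).1).
  have := wn n.
  have -> : rdot p.1 (s n).1 - rdot p.2 y = w - rdot p.1 (z - (s n).1).
    by rewrite /w rdotBr; ring.
  move: cs; set d := rdot _ _ => cs hw.
  have hw2 : w ^+ 2 <= 2 * (w - d) ^+ 2 + 2 * d ^+ 2.
    have -> : 2 * (w - d) ^+ 2 + 2 * d ^+ 2 = w ^+ 2 + (w - 2 * d) ^+ 2 by ring.
    by rewrite lerDl sqr_ge0.
  have k1 : q1 * n.+1%:R^-1 <= e / 4.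
    rewrite mulrC -ler_pdivlMr// -mulrA -invfM ltW//.
  have k2 : normsq p.1 * normsq (z - (s n).1) <= e / 4.
    apply: (@le_trans _ _ (q1 * normsq (z - (s n).1))).
      by rewrite ler_wpM2r ?normsq_ge0// /q1; lra.
    rewrite mulrC -ler_pdivlMr// -mulrA -invfM ltW//.
  have {hw k1} hw := le_trans hw k1; have {cs k2} hd := le_trans cs k2.
  by move: ((w - d) ^+ 2) (d ^+ 2) hw hd hw2 => a b; clear; lra.
exists z; split=> [p Sp|e e0]; last first.
  have [N h] := zs _ e0; exists (s N); [exact: (sP N).1|exact: h].
rewrite [LHS]hdotE [RHS]hdotE zS//; congr (Complex _ _).
by have := Sl (- 'i%C) p _ Sp S0; rewrite /= !addr0 => /zS.
Qed.

End Riesz.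

(** * Operators and adjoints *)

Section Adjoint.
Context {R : realType}.
Local Notation C := (cplx R).
Local Notation Re := complex.Re.
Local Notation Im := complex.Im.
Implicit Types (H K L : hilbertType R).

Lemma bop_compE H K L (v : bop K L) (w : bop H K) x : (v \oB w) x = v (w x).
Proof. by []. Qed.

Lemma bopDE H K (v w : bop H K) x : (v + w) x = v x + w x.
Proof. by []. Qed.
Lemma bopZE H K (a : C) (v : bop H K) x : (a *: v) x = a *: v x.
Proof. by []. Qed.
Lemma bop0E H K x : (0 : bop H K) x = 0.
Proof. by []. Qed.

Definition orth H (D : set H) : set H :=
  [set z | forall d, D d -> hdot d z = 0 :> C].

(** In place of the closure of a subspace [D] its double orthogonal is used: a
    vector there is determined by its inner products with [D]. *)
Lemma orth_orth_eq H (D : set H) (x y : H) : orth (orth D) x -> orth (orth D) y ->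
  (forall d, D d -> hdot d x = hdot d y :> C) -> x = y.
Proof.
move=> ox oy xy; apply/eqP; rewrite -subr_eq0; apply/eqP/hdot_eq0.
have dO : orth D (x - y) by move=> d Dd; rewrite hdotBr xy// subrr.
by rewrite hdotBr ox// oy// subrr.
Qed.

Lemma orth_linear H (D : set H) (a : C) (x y : H) :
  orth D x -> orth D y -> orth D (a *: x + y).
Proof. by move=> ox oy d Dd; rewrite hdotDr hdotZr ox// oy// mulr0 addr0. Qed.

Lemma closure_orth H (D : set H) (z : H) :
  (forall e : R, 0 < e -> exists2 x, D x & normsq (z - x) < e) -> orth (orth D) z.
Proof.
move=> zD.
have h a : orth D a -> rdot a z = 0.
  move=> aD; apply/eqP; rewrite -sqrf_eq0 eq_le sqr_ge0 andbT.
  apply/ler_addgt0Pl => e e0; rewrite addr0.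
  have a1 : 0 < normsq a + 1 by rewrite ltr_wpDl ?normsq_ge0.
  have [x Dx] := zD _ (divr_gt0 e0 a1).
  rewrite ltr_pdivlMr// => zx.
  have -> : rdot a z = rdot a (z - x).
    have xa : rdot x a = 0 by rewrite rdotE aD.
    by rewrite rdotBr [rdot a x]rdotC xa subr0.
  rewrite (le_trans (rdot_CS _ _))//; have := normsq_ge0 (z - x); nra.
move=> d dD; rewrite hdotE !h//.
by rewrite -[_ *: d]addr0; apply: orth_linear => // x _; rewrite hdot0r.
Qed.

(** The vectors given by [riesz_relation] depend linearly on [y] because they are
    unique in the double orthogonal of the domain.  If [S] is the graph of a
    bounded map defined on a subspace, then [T] is the adjoint of its extension by
    zero on the orthogonal complement. *)
Lemma bounded_rel_adjoint H K (S : set (H * K)) (c : R) :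
  rel_subspace S -> 0 < c -> (forall p, S p -> normsq p.2 <= c * normsq p.1) ->
  exists T : bop K H, (forall p y, S p -> hdot p.1 (T y) = hdot p.2 y :> C) /\
    forall y, orth (orth (fst @` S)) (T y).
Proof.
move=> Ss c0 Sc.
have /choice[T TP] : forall y, exists z : H,
    (forall p, S p -> hdot p.1 z = hdot p.2 y :> C) /\
    forall e : R, 0 < e -> exists2 p, S p & normsq (z - p.1) < e.
  by move=> y; exact: riesz_relation Ss Sc c0.
have TO y : orth (orth (fst @` S)) (T y).
  apply: closure_orth => e e0; have [p Sp pe] := (TP y).2 e e0.
  by exists p.1 => //; exists p.
have lT : linear T.
  move=> a x y; apply: (orth_orth_eq (TO _)); first exact: orth_linear.
  move=> _ [p Sp <-]; rewrite hdotDr hdotZr.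
  by rewrite !(TP _).1// hdotDr hdotZr.
have bT y : normsq (T y) <= c * normsq y.
  apply/ler_addgt0Pl => e e0; have [p Sp pe] := (TP y).2 e e0.
  have : rdot p.1 (T y) = rdot p.2 y by rewrite !rdotE (TP y).1.
  move: pe; rewrite normsqB (rdotC (T y)) => pe he; move: pe; rewrite he.
  have := rdot_AMGM (((c^-1)%:C%C : C) *: p.2) y; rewrite normsqZr rdotZl => h.
  have {}h : c * (2 * (c^-1 * rdot p.2 y)) <= c * (c^-1 ^+ 2 * normsq p.2 + normsq y).
    by rewrite ler_wpM2l// ltW.
  have k1 : c * (2 * (c^-1 * rdot p.2 y)) = 2 * rdot p.2 y.
    by field; exact: lt0r_neq0.
  have k2 : c * (c^-1 ^+ 2 * normsq p.2 + normsq y) = c^-1 * normsq p.2 + c * normsq y.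
    by field; exact: lt0r_neq0.
  have : c^-1 * normsq p.2 <= normsq p.1 by rewrite ler_pdivrMl// Sc.
  move: h; rewrite k1 k2; lra.
exists (Bop (bounded_normsq lT (ltW c0) bT)); split=> // p y Sp.
exact: (TP y).1.
Qed.

Lemma adjoint_exists H K (v : bop H K) : exists w : bop K H, adjoint v w.
Proof.
have [c c0 vc] := bop_bounded v.
pose S := [set p : H * K | p.2 = v p.1].
have [|p -> //|T [TP _]] := @bounded_rel_adjoint H K S c _ c0.
  split=> [|a p q pS qS]; rewrite /S /= ?linear0//.
  by rewrite linearP pS qS.
by exists T => x y; rewrite (TP (x, v x) y).
Qed.

(** A chosen adjoint; it is the only one, see [adjE]. *)
Definition adj H K (v : bop H K) : bop K H := sval (cid (adjoint_exists v)).

Lemma adjP H K (v : bop H K) x y : hdot (v x) y = hdot x (adj v y) :> C.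
Proof. exact: (svalP (cid (adjoint_exists v))). Qed.

Lemma adjPr H K (v : bop H K) x y : hdot x (v y) = hdot (adj v x) y :> C.
Proof. by rewrite [LHS]hdotC adjP -hdotC. Qed.

Lemma adjE H K (v : bop H K) (w : bop K H) : adjoint v w -> w = adj v.
Proof.
by move=> vw; apply: bopE => y; apply: hdot_inj => z; rewrite -vw adjP.
Qed.

Lemma adjK H K (v : bop H K) : adj (adj v) = v.
Proof. by apply/esym/adjE => x y; rewrite adjPr. Qed.

Lemma adj_comp H K L (v : bop K L) (w : bop H K) :
  adj (v \oB w) = adj w \oB adj v.
Proof. by apply/esym/adjE => x y; rewrite !bop_compE !adjP. Qed.

Lemma rdot_adj H K (v : bop H K) x y : rdot (v x) y = rdot x (adj v y).
Proof. by rewrite !rdotE adjP. Qed.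

Lemma adj_bound H K (v : bop H K) (c : R) : 0 <= c ->
  (forall x, normsq (v x) <= c * normsq x) -> forall y, normsq (adj v y) <= c * normsq y.
Proof.
move=> c0 vc y; have := rdot_CS (v (adj v y)) y; rewrite rdot_adj -/(normsq _) => h.
have := le_trans h (ler_wpM2r (normsq_ge0 y) (vc (adj v y))).
have := normsq_ge0 (adj v y); rewrite le_eqVlt => /predU1P[<- _|a0].
  by rewrite mulr_ge0// normsq_ge0.
by rewrite mulrAC expr2 ler_pM2r.
Qed.

Lemma bop_compA H K L L' (u : bop L L') (v : bop K L) (w : bop H K) :
  u \oB v \oB w = u \oB (v \oB w).
Proof. exact: bopE. Qed.
Lemma bop_comp1 H K (v : bop H K) : v \oB bop1 H = v.
Proof. exact: bopE. Qed.
Lemma bop_1comp H K (v : bop H K) : bop1 K \oB v = v.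
Proof. exact: bopE. Qed.

Lemma bop_comp_linearl H K L (a : C) (v w : bop K L) (u : bop H K) :
  (a *: v + w) \oB u = a *: (v \oB u) + w \oB u.
Proof. exact: bopE. Qed.
Lemma bop_comp_linearr H K L (a : C) (v w : bop H K) (u : bop K L) :
  u \oB (a *: v + w) = a *: (u \oB v) + u \oB w.
Proof. by apply: bopE => x; rewrite bop_compE bopDE bopZE linearP. Qed.
Lemma bop_comp0 H K L (u : bop K L) : u \oB (0 : bop H K) = 0.
Proof. by apply: bopE => x; rewrite bop_compE !bop0E linear0. Qed.
Lemma bop_0comp H K L (u : bop H K) : (0 : bop K L) \oB u = 0.
Proof. exact: bopE. Qed.
Lemma adj_linear H K (a : C) (v w : bop H K) :
  adj (a *: v + w) = Num.conj a *: adj v + adj w.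
Proof.
apply/esym/adjE => x y.
rewrite !bopDE !bopZE hdotDl hdotDr hdotZl hdotZr conjCK !adjP//.
Qed.
Lemma adj0 H K : adj (0 : bop H K) = 0.
Proof. by apply/esym/adjE => x y; rewrite !bop0E hdot0l hdot0r. Qed.

End Adjoint.

(** * The norm of a positive definite form *)

Section FormNorm.
Context {R : realType}.
Local Notation C := (cplx R).
Local Notation Re := complex.Re.
Local Notation Im := complex.Im.
Implicit Types (H K L : hilbertType R).

(** The discriminant of a nonnegative quadratic polynomial; if [c = 0], then [b]
    vanishes because [t] is unrestricted. *)
Lemma quad_ge0_CS (a b c : R) : 0 <= c ->
  (forall t : R, 0 <= a + 2 * t * b + t ^+ 2 * c) -> b ^+ 2 <= a * c.
Proof.
rewrite le_eqVlt => /predU1P[<- h|c0 h].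
  rewrite mulr0; have [->|b0] := eqVneq b 0; first by rewrite expr0n.
  have := h (- (a + 1) / (2 * b)); rewrite mulr0 addr0.
  have -> : a + 2 * (- (a + 1) / (2 * b)) * b = - 1 by field.
  by rewrite leNgt ltrN10.
have := h (- b / c).
have -> : a + 2 * (- b / c) * b + (- b / c) ^+ 2 * c = (a * c - b ^+ 2) / c.
  by field; exact: lt0r_neq0.
by rewrite pmulr_lge0 ?invr_gt0// subr_ge0.
Qed.

Section DotNorm.
Variables (U : lmodType C) (form : {dot U for (@Num.conj C)}).

Definition formsq (u : U) : R := Re (form u u).

Lemma formsqE u : form u u = ((formsq u)%:C%C : C).
Proof.
by rewrite RRe_real// ger0_real.
Qed.

Lemma formsq_ge0 u : 0 <= formsq u.
Proof.
by rewrite -lecR -formsqE; exact: dnorm_ge0.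
Qed.

Lemma formsq_eq0 u : formsq u = 0 -> u = 0.
Proof.
by move=> u0; apply/eqP; rewrite -(dnorm_eq0 form) formsqE u0.
Qed.

Lemma formsqZ (a : C) u : formsq (a *: u) = (Re a ^+ 2 + Im a ^+ 2) * formsq u.
Proof.
rewrite /formsq linearZl_LR linearZr_LR /= mulrA formsqE; case: a => a b.
rewrite ReM /= mulr0 subr0; congr (_ * _); ring.
Qed.

Lemma formsqD u v : formsq (u + v) = formsq u + 2 * Re (form u v) + formsq v.
Proof.
rewrite /formsq dnormD !ReD ReJ; ring.
Qed.

Lemma form_CS u v : (Re (form u v)) ^+ 2 <= formsq u * formsq v.
Proof.
apply: quad_ge0_CS; first exact: formsq_ge0.
move=> t; have := formsq_ge0 (u + (t%:C%C : C) *: v).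
rewrite formsqD formsqZ /= expr0n addr0 linearZr_LR /= ReM /= oppr0 mul0r subr0.
by rewrite mulrA.
Qed.

Definition dotnorm (u : U) : C := (Num.sqrt (formsq u))%:C%C.

Lemma ler_dotnormD u v : dotnorm (u + v) <= dotnorm u + dotnorm v.
Proof.
rewrite /dotnorm -(rmorphD (real_complex R)) lecR.
have [u0 v0] := (sqrtr_ge0 (formsq u), sqrtr_ge0 (formsq v)).
rewrite -(@ler_pXn2r _ 2) ?nnegrE ?addr_ge0 ?sqrtr_ge0//.
rewrite sqr_sqrtr ?formsq_ge0// sqrrD !sqr_sqrtr ?formsq_ge0// formsqD.
rewrite lerD2r lerD2l -[leRHS]mulr_natl ler_pM2l//.
rewrite -sqrtrM ?formsq_ge0//; apply: le_trans (ler_norm _) _.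
by rewrite -sqrtr_sqr ler_wsqrtr// form_CS.
Qed.

Lemma dotnormZ (a : C) u : dotnorm (a *: u) = `|a| * dotnorm u.
Proof.
rewrite /dotnorm formsqZ sqrtrM ?addr_ge0 ?sqr_ge0// normc_def.
by rewrite (rmorphM (real_complex R)).
Qed.

Lemma dotnorm_eq0 u : dotnorm u = 0 -> u = 0.
Proof.
move=> /eqP; rewrite -[0]/(0%:C%C) => /eqP /complexI /eqP; rewrite sqrtr_eq0 => h.
by apply: formsq_eq0; apply/eqP; rewrite eq_le h formsq_ge0.
Qed.
End DotNorm.

End FormNorm.

(** * The Hilbert space of square-summable sequences *)

Section SquareSummable.
Context {R : realType}.
Local Notation C := (cplx R).
Local Notation Re := complex.Re.
Local Notation Im := complex.Im.
Implicit Types (H K L : hilbertType R).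

Lemma cvg_RtoC (u : nat -> R) (l : R) :
  u @ \oo --> l -> (fun n => ((u n)%:C%C : C)) @ \oo --> (l%:C%C : C).
Proof.
move=> ul; apply/cvgrPdist_lt => e /gtc0_real[r r0 ->].
near=> n; rewrite -(rmorphB (real_complex R)) normc_def /= expr0n addr0 sqrtr_sqr.
by rewrite ltcR; near: n; move/cvgrPdist_lt: ul; exact.
Unshelve. all: by end_near. Qed.

Lemma cvg_Re (u : nat -> C) (l : C) :
  u @ \oo --> l -> (fun n => Re (u n)) @ \oo --> Re l.
Proof.
move=> ul; apply/cvgrPdist_lt => e e0.
near=> n; rewrite -ReN -ReD -ltcR.
apply: le_lt_trans (normc_ge_Re _) _.
by near: n; move/cvgrPdist_lt: ul; apply; rewrite ltcR.
Unshelve. all: by end_near. Qed.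

Lemma Re_sum I (s : seq I) (F : I -> C) :
  Re (\sum_(i <- s) F i) = \sum_(i <- s) Re (F i).
Proof.
by elim: s => [|i s IH]; rewrite ?big_nil// !big_cons ReD IH.
Qed.

Lemma cvg_series_bound (u : nat -> R) (M : R) : (forall n, 0 <= u n) ->
  (forall n, \sum_(0 <= i < n) u i <= M) -> cvgn (series u).
Proof.
move=> u0 uM; apply: nondecreasing_is_cvgn.
  exact: nondecreasing_series.
by exists M => _ [n _ <-]; exact: uM.
Qed.

Lemma series_le_lim (u : nat -> R) : (forall n, 0 <= u n) -> cvgn (series u) ->
  forall n, \sum_(0 <= i < n) u i <= limn (series u).
Proof.
move=> u0 cu n; apply: (nondecreasing_cvgn_le _ cu).
exact: nondecreasing_series.
Qed.

Lemma lim_series_bound (u : nat -> R) (M : R) : (forall n, 0 <= u n) ->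
  (forall n, \sum_(0 <= i < n) u i <= M) -> limn (series u) <= M.
Proof.
move=> u0 uM; apply: limr_le; first exact: cvg_series_bound uM.
by near=> n; exact: uM.
Unshelve. all: by end_near. Qed.

(** Monotone convergence.  The series of the definition is complex-valued, whereas
    the partial sums here are real. *)
Lemma square_summableP H (x : nat -> H) : square_summable x <->
  exists M, forall n, \sum_(0 <= i < n) normsq (x i) <= M.
Proof.
split=> [cx|[M xM]].
  have /(cvgP _) : Re (series (fun n => `|x n| ^+ 2 : C) n) @[n --> \oo] -->
    Re (limn (series (fun n => `|x n| ^+ 2 : C))) by apply: cvg_Re.
  have -> : (fun n => Re (series (fun n => `|x n| ^+ 2 : C) n)) =
      series (fun n => normsq (x n)).
    by apply/funext => n; rewrite !seriesEnat /= Re_sum;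
      apply: eq_bigr => i _; rewrite normsqE.
  move=> cq; exists (limn (series (fun n => normsq (x n)))).
  by apply: series_le_lim => // n; exact: normsq_ge0.
have cq := cvg_series_bound (fun n => normsq_ge0 (x n)) xM.
have := cvgP _ (cvg_RtoC cq).
have -> // : (fun n => ((series (fun n => normsq (x n)) n)%:C%C : C)) =
      series (fun n => `|x n| ^+ 2).
apply/funext => n; rewrite !seriesEnat /= (rmorph_sum (real_complex R)).
by apply: eq_bigr => i _; rewrite normsqE.
Qed.

Definition l2_pred {H} : {pred nat -> H} := fun x => `[< square_summable x >].

Lemma l2_submod H : submod_closed (@l2_pred H).
Proof.
split=> [|a x y].
  apply/asboolP/square_summableP; exists 0 => n.
  by rewrite big1// => i _; rewrite normsq0.
move=> /asboolP/square_summableP[M xM] /asboolP/square_summableP[M' yM'].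
apply/asboolP/square_summableP.
exists (2 * (Re a ^+ 2 + Im a ^+ 2) * M + 2 * M') => n.
apply: (@le_trans _ _ (\sum_(0 <= i < n)
    (2 * (Re a ^+ 2 + Im a ^+ 2) * normsq (x i) + 2 * normsq (y i)))).
  by apply: ler_sum => i _; rewrite (le_trans (normsqD_le _ _))// normsqZ mulrA.
rewrite big_split /= -!mulr_sumr lerD// ler_wpM2l// mulr_ge0// addr_ge0 ?sqr_ge0//.
Qed.
HB.instance Definition _ H :=
  GRing.isSubmodClosed.Build _ _ (@l2_pred H) (@l2_submod H).

Record l2 (H : hilbertType R) := L2 { l2_fun :> nat -> H; l2P : l2_fun \in l2_pred }.
HB.instance Definition _ H := [isSub for @l2_fun H].
HB.instance Definition _ H := [Choice of l2 H by <:].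
HB.instance Definition _ H := [SubChoice_isSubLmodule of l2 H by <:].

Lemma l2_summable H (x : l2 H) : square_summable x.
Proof. by have /asboolP := l2P x. Qed.

Lemma l2_bounded H (x : l2 H) : exists M, forall n, \sum_(0 <= i < n) normsq (x i) <= M.
Proof. exact/square_summableP/l2_summable. Qed.

Lemma l2DE H (x y : l2 H) n : (x + y) n = x n + y n. Proof. by []. Qed.
Lemma l2ZE H (a : C) (x : l2 H) n : (a *: x) n = a *: x n. Proof. by []. Qed.
Lemma l2BE H (x y : l2 H) n : (x - y) n = x n - y n. Proof. by []. Qed.
Lemma l2_eqP H (x y : l2 H) : (forall n, x n = y n) -> x = y.
Proof. by move=> xy; apply/val_inj/funext. Qed.

Lemma cvg_rdot_series H (x y : nat -> H) : square_summable x -> square_summable y ->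
  cvgn (series (fun n => rdot (x n) (y n))).
Proof.
move=> /square_summableP[M xM] /square_summableP[M' yM].
apply: normed_cvg.
apply: (@cvg_series_bound _ (M + M')) => n; first exact: normr_ge0.
apply: (@le_trans _ _ (\sum_(0 <= i < n) (normsq (x i) + normsq (y i)))); last first.
  by rewrite big_split lerD.
apply: ler_sum => i _ /=.
have := rdot_AMGM (x i) (y i); have := rdot_AMGM (- x i) (y i).
rewrite rdotNl normsqN; have := normsq_ge0 (x i); have := normsq_ge0 (y i).
rewrite ler_norml; lra.
Qed.

Lemma cvg_hdot_series H (x y : nat -> H) : square_summable x -> square_summable y ->
  cvgn (series (fun n => hdot (x n) (y n) : C)).
Proof.
move=> sx sy.
have six : square_summable (fun n => - ('i%C : C) *: x n).
  have /square_summableP[M xM] := sx; apply/square_summableP; exists M => n.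
  apply: le_trans (xM n); apply: ler_sum => i _.
  by rewrite normsqZ /= oppr0 expr0n /= add0r sqrrN expr1n mul1r.
have -> : series (fun n => hdot (x n) (y n) : C) =
   (fun n => (series (fun n => rdot (x n) (y n)) n)%:C%C +
     ('i%C : C) * (series (fun n => rdot (- ('i%C : C) *: x n) (y n)) n)%:C%C).
  apply/funext => n; rewrite !seriesEnat /=.
  rewrite !(rmorph_sum (real_complex R)) mulr_sumr -big_split; apply: eq_bigr => i _.
  by rewrite [LHS]complexE [in LHS]hdotE.
apply: is_cvgD.
  exact: cvgP (cvg_RtoC (cvg_rdot_series sx sy)).
apply: is_cvgMr.
exact: cvgP (cvg_RtoC (cvg_rdot_series six sy)).
Qed.

End SquareSummable.

Section L2Dot.
Context {R : realType}.
Local Notation C := (cplx R).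
Local Notation Re := complex.Re.
Local Notation Im := complex.Im.
Implicit Types (H K L : hilbertType R).

(** The pairing that defines the ultraweak functionals is the inner product of
    [l2 H]. *)
Definition l2dot H (x y : l2 H) : C := limn (series (fun n => hdot (x n) (y n) : C)).

Lemma l2dot_cvg H (x y : l2 H) :
  series (fun n => hdot (x n) (y n) : C) @ \oo --> l2dot x y.
Proof. exact: (cvg_hdot_series (@l2_summable _ _ x) (@l2_summable _ _ y)). Qed.

Lemma l2dot_eq H (x y : l2 H) (l : C) :
  series (fun n => hdot (x n) (y n) : C) @ \oo --> l -> l2dot x y = l.
Proof. exact: cvg_lim. Qed.

Lemma l2dotPl H (y : l2 H) : linear_for *%R (fun x => l2dot x y).
Proof.
move=> a x x'; apply: l2dot_eq.
have -> : series (fun n => hdot ((a *: x + x') n) (y n) : C) =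
   a \*: (series (fun n => hdot (x n) (y n) : C) : nat -> C^o) \+
   series (fun n => hdot (x' n) (y n) : C).
  apply/funext => n; rewrite /= !seriesEnat /= scaler_sumr -big_split.
  by apply: eq_bigr => i _; rewrite hdotDl hdotZl.
by apply: cvgD; [apply: cvgZr|]; exact: l2dot_cvg.
Qed.

Lemma l2dotC H (x y : l2 H) : l2dot x y = Num.conj (l2dot y x).
Proof.
apply: l2dot_eq.
have -> : series (fun n => hdot (x n) (y n) : C) =
   (fun n => Num.conj (series (fun n => hdot (y n) (x n) : C) n)).
  apply/funext => n; rewrite /= !seriesEnat /= rmorph_sum.
  by apply: eq_bigr => i _; rewrite [LHS]hdotC.
apply/cvgrPdist_lt => e e0; near=> n.
rewrite -rmorphB normcJ; near: n.
by move/cvgrPdist_lt: (@l2dot_cvg _ y x); exact.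
Unshelve. all: by end_near. Qed.

Lemma l2dotPr H (x : l2 H) : linear_for (Num.conj \; *%R) (l2dot x).
Proof.
move=> a y y'; rewrite /= l2dotC l2dotPl rmorphD rmorphM /=.
by congr (_ * _ + _); rewrite -l2dotC.
Qed.

HB.instance Definition _ H := @bilinear_isBilinear.Build C (l2 H) (l2 H) C
  *%R (Num.conj \; *%R) (@l2dot H) (@l2dotPl H, @l2dotPr H).

Lemma l2dot_herm H (x y : l2 H) : l2dot x y = (-1) ^+ false * Num.conj (l2dot y x).
Proof. by rewrite expr0 mul1r -l2dotC. Qed.
HB.instance Definition _ H := @isHermitianSesquilinear.Build C (l2 H) false
  Num.conj (@l2dot H) (@l2dot_herm H).

Lemma l2dot_xx H (x : l2 H) : l2dot x x = (limn (series (fun n => normsq (x n))))%:C%C.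
Proof.
apply: l2dot_eq.
have -> : series (fun n => hdot (x n) (x n) : C) =
   (fun n => (series (fun n => normsq (x n)) n)%:C%C).
  apply/funext => n; rewrite /= !seriesEnat /= (rmorph_sum (real_complex R)).
  by apply: eq_bigr => i _; rewrite hdot_normsq.
apply: cvg_RtoC; have [M xM] := l2_bounded x.
by apply: cvg_series_bound xM => n; exact: normsq_ge0.
Qed.

Lemma l2_partial H (x : l2 H) n : \sum_(0 <= i < n) normsq (x i) <= Re (l2dot x x).
Proof.
rewrite l2dot_xx /=; have [M xM] := l2_bounded x.
have x0 k : 0 <= normsq (x k) by exact: normsq_ge0.
exact: (series_le_lim x0 (cvg_series_bound x0 xM)).
Qed.

Lemma l2_coord_le H (x : l2 H) n : normsq (x n) <= Re (l2dot x x).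
Proof.
apply: le_trans (l2_partial x n.+1).
by rewrite big_nat_recr //= lerDr sumr_ge0// => i _; exact: normsq_ge0.
Qed.

Lemma l2dot_gt0 H (x : l2 H) : x != 0 -> 0 < l2dot x x.
Proof.
move=> x0; rewrite l2dot_xx ltcR lt_neqAle; apply/andP; split; last first.
  by have := l2_partial x 0; rewrite big_nil l2dot_xx.
apply: contra x0 => /eqP x0; apply/eqP/l2_eqP => n; apply: normsq_eq0.
by apply/eqP; rewrite eq_le normsq_ge0 andbT (le_trans (l2_coord_le _ _))// l2dot_xx -x0.
Qed.
HB.instance Definition _ H := @isDotProduct.Build C (l2 H) (@l2dot H) (@l2dot_gt0 H).

Definition l2form H : {dot (l2 H) for (@Num.conj C)} := @l2dot H.

HB.instance Definition _ H := Lmodule_isNormed.Build C (l2 H)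
  (@ler_dotnormD _ _ (l2form H)) (@dotnormZ _ _ (l2form H)) (@dotnorm_eq0 _ _ (l2form H)).

End L2Dot.

Section L2Complete.
Context {R : realType}.
Local Notation C := (cplx R).
Local Notation Re := complex.Re.
Local Notation Im := complex.Im.
Implicit Types (H K L : hilbertType R).

Definition l2normsq H (x : l2 H) : R := Re (l2dot x x).

Lemma l2_normE H (x : l2 H) : `|x| = (Num.sqrt (l2normsq x))%:C%C.
Proof. by []. Qed.

Lemma l2normsq_ge0 H (x : l2 H) : 0 <= l2normsq x.
Proof. exact: (formsq_ge0 (l2form H)). Qed.

Lemma l2norm_lt H (x : l2 H) (e : R) : 0 < e ->
  (`|x| < (e%:C%C : C)) = (l2normsq x < e ^+ 2).
Proof.
move=> e0; rewrite l2_normE ltcR -(@ltr_pXn2r _ 2) ?nnegrE ?sqrtr_ge0 ?(ltW e0)//.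
by rewrite sqr_sqrtr// l2normsq_ge0.
Qed.

Lemma l2_normsq H (x : l2 H) : l2dot x x = `|x| ^+ 2.
Proof.
rewrite l2_normE -rmorphXn sqr_sqrtr ?l2normsq_ge0//.
exact: (formsqE (l2form H)).
Qed.

Lemma l2normsq_bound H (x : l2 H) M : (forall n, \sum_(0 <= i < n) normsq (x i) <= M) ->
  l2normsq x <= M.
Proof.
by move=> xM; rewrite /l2normsq l2dot_xx /= lim_series_bound// => n; exact: normsq_ge0.
Qed.

Lemma l2normsqB_le H (x y : l2 H) : l2normsq (x - y) <= 2 * l2normsq x + 2 * l2normsq y.
Proof.
apply: l2normsq_bound => n.
apply: (@le_trans _ _ (\sum_(0 <= i < n) (2 * normsq (x i) + 2 * normsq (y i)))).
  by apply: ler_sum => i _; exact: normsqB_le.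
by rewrite big_split /= -!mulr_sumr lerD// ler_pM2l// l2_partial.
Qed.

Lemma l2normsqBC H (x y : l2 H) : l2normsq (x - y) = l2normsq (y - x).
Proof. by rewrite -opprB /l2normsq (hnormN (l2form H)). Qed.

(** A Cauchy filter is replaced by a sequence of approximate limits, whose
    coordinates converge; the bound on the distance to the limit is obtained on
    each finite set of coordinates. *)
Lemma l2_complete H (F : set_system (l2 H)) : ProperFilter F -> cauchy F -> cvg F.
Proof.
move=> FF /cauchyP FC.
(* The radii a n satisfy a n ^+ 2 <= a n, so squared radii can be estimated by a n. *)
pose a (n : nat) : R := n.+1%:R^-1.
have a0 n : 0 < a n by rewrite invr_gt0.
have a1 n : a n ^+ 2 <= a n.
  by rewrite expr2 ler_piMr ?(ltW (a0 _))// invf_le1// ler1n.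
have /choice[x xF] : forall n, exists x : l2 H, F [set z | l2normsq (x - z) < a n].
  move=> n; have [|x Fx] := FC (a n)%:C%C; first by rewrite ltcR.
  exists x; apply: filterS Fx => z; rewrite -ball_normE /= l2norm_lt// => h.
  exact: lt_le_trans h (a1 n).
have xC m n : l2normsq (x m - x n) <= 2 * a m + 2 * a n.
  have [z [zm zn]] := filter_ex (filterI (xF m) (xF n)).
  have := l2normsqB_le (x m - z) (x n - z); rewrite opprB addrA subrK.
  move: zm zn => /=; move: (l2normsq (x m - z)) (l2normsq (x n - z)) (l2normsq (x m - x n)).
  by move: (a m) (a n) => *; lra.
have a_small e : 0 < e -> exists N, forall n, (N <= n)%N -> a n < e.
  exact: invnS_small.
have /choice[y yP] : forall k, exists y, forall e : R, 0 < e ->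
    exists N, forall n, (N <= n)%N -> normsq (y - x n k) < e.
  move=> k; apply: (@normsq_complete _ _ (fun n => x n k)) => e e0.
  have [N Nh] := a_small (e / 4) (divr_gt0 e0 (ltr0n _ 4)).
  exists N => m n /Nh hm /Nh hn.
  rewrite -l2BE; apply: le_lt_trans (l2_coord_le _ _) _.
  apply: le_lt_trans (xC m n) _; move: (a m) (a n) hm hn => b c; lra.
have ysum N e : 0 < e -> exists M, forall m, (M <= m)%N ->
    \sum_(0 <= k < N) normsq (y k - x m k) < e.
  elim: N e => [|N IH] e e0; first by exists 0%N => m _; rewrite big_nil.
  have e2 : 0 < e / 2 by rewrite divr_gt0.
  have [M1 h1] := IH _ e2; have [M2 h2] := yP N _ e2.
  exists (maxn M1 M2) => m; rewrite geq_max => /andP[/h1 m1 /h2 m2].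
  by rewrite big_nat_recr //= [ltRHS]splitr ltrD.
have yx N n : \sum_(0 <= k < N) normsq (y k - x n k) <= 4 * a n.
  apply/ler_addgt0Pl => e e0.
  have e8 : 0 < e / 8 by rewrite divr_gt0.
  have [M1 h1] := ysum N _ e8; have [M2 h2] := a_small _ e8.
  pose m := maxn M1 M2; have {}h1 := h1 m (leq_maxl _ _).
  have {}h2 := h2 m (leq_maxr _ _).
  have h3 : \sum_(0 <= k < N) normsq (y k - x n k) <=
     2 * \sum_(0 <= k < N) normsq (y k - x m k) + 2 * l2normsq (x m - x n).
    apply: (@le_trans _ _ (2 * \sum_(0 <= k < N) normsq (y k - x m k) +
        2 * \sum_(0 <= k < N) normsq ((x m - x n) k))).
      rewrite !mulr_sumr -big_split; apply: ler_sum => k _ /=.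
      by have := normsqD_le (y k - x m k) ((x m - x n) k); rewrite l2BE addrA subrK.
    by rewrite lerD2l ler_pM2l// l2_partial.
  have := xC m n; move: h1 h2 h3.
  move: (\sum_(0 <= k < N) _) (\sum_(0 <= k < N) _) (a m) (a n) (l2normsq _).
  move=> *; lra.
have y0 : (fun k => y k - x 0 k) \in l2_pred.
  by apply/asboolP/square_summableP; exists (4 * a 0) => n; exact: yx.
pose z : l2 H := L2 y0 + x 0.
have zE k : z k = y k by rewrite l2DE /= subrK.
have zx n : l2normsq (z - x n) <= 4 * a n.
  apply: l2normsq_bound => N; apply: le_trans (yx N n).
  by apply: ler_sum => k _; rewrite l2BE zE.
apply/cvg_ex; exists z; apply/fcvg_ballP => e /gtc0_real[r r0 ->].
have r2 : 0 < r ^+ 2 / 10 by rewrite divr_gt0// exprn_gt0.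
have [N Nh] := a_small _ r2.
apply: filterS (xF N) => w /= xw; rewrite -ball_normE /= l2norm_lt//.
have := l2normsqB_le (z - x N) (w - x N); rewrite opprB addrA subrK (l2normsqBC w).
have := zx N; have := Nh N (leqnn N); move: xw.
move: (a N) (r ^+ 2) (l2normsq (z - x N)) (l2normsq (x N - w)) (l2normsq (z - w)) => *; lra.
Qed.

HB.instance Definition _ H := Uniform_isComplete.Build (l2 H) (@l2_complete H).

HB.instance Definition _ H := @isHilbert.Build R (l2 H) (l2form H) (@l2_normsq H).

End L2Complete.

(** * Amplifications, coordinates and isometries *)

Section Amplification.
Context {R : realType}.
Local Notation C := (cplx R).
Local Notation Re := complex.Re.
Local Notation Im := complex.Im.
Implicit Types (H K L : hilbertType R).

Lemma l2_hdotE H (x y : l2 H) : hdot x y = l2dot x y :> C.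
Proof. by []. Qed.
Lemma l2_normsqE H (x : l2 H) : normsq x = l2normsq x.
Proof. by rewrite /normsq rdotE. Qed.
Lemma normsq_partial H (x : l2 H) n : \sum_(0 <= i < n) normsq (x i) <= normsq x.
Proof. by rewrite l2_normsqE; exact: l2_partial. Qed.
Lemma normsq_coord H (x : l2 H) n : normsq (x n) <= normsq x.
Proof. by rewrite l2_normsqE; exact: l2_coord_le. Qed.
Lemma normsq_bound H (x : l2 H) M : (forall n, \sum_(0 <= i < n) normsq (x i) <= M) ->
  normsq x <= M.
Proof. by rewrite l2_normsqE; exact: l2normsq_bound. Qed.

Lemma l2_pred_bound H (x : nat -> H) M : (forall n, \sum_(0 <= i < n) normsq (x i) <= M) ->
  x \in l2_pred.
Proof. by move=> xM; apply/asboolP/square_summableP; exists M. Qed.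

(** Polarisation. *)
Lemma isometry_hdot H K (v : bop H K) : (forall x, normsq (v x) = normsq x) ->
  forall x y, hdot (v x) (v y) = hdot x y :> C.
Proof.
move=> vi; have ri x y : rdot (v x) (v y) = rdot x y.
  by have := vi (x + y); rewrite linearD !normsqD !vi; lra.
by move=> x y; rewrite [LHS]hdotE [RHS]hdotE -linearZ !ri.
Qed.

Section Amp.
Variables (H K : hilbertType R) (v : bop H K).

Lemma amp_sum_le (c : R) (x : l2 H) : (forall h, normsq (v h) <= c * normsq h) -> 0 <= c ->
  forall n, \sum_(0 <= i < n) normsq (v (x i)) <= c * normsq x.
Proof.
move=> vc c0 n; apply: (@le_trans _ _ (\sum_(0 <= i < n) c * normsq (x i))).
  by apply: ler_sum.
by rewrite -mulr_sumr ler_wpM2l// normsq_partial.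
Qed.

Lemma amp_l2 (x : l2 H) : (fun n => v (x n)) \in l2_pred.
Proof.
have [c c0 vc] := bop_bounded v.
exact: l2_pred_bound (amp_sum_le x vc (ltW c0)).
Qed.

Definition amp_fun (x : l2 H) : l2 K := L2 (amp_l2 x).

Lemma amp_bounded : amp_fun \in bounded_op.
Proof.
have [c c0 vc] := bop_bounded v.
apply: (bounded_normsq _ (ltW c0)) => [a x y|x].
  by apply: l2_eqP => n; rewrite /= linearP.
by apply: normsq_bound; exact: amp_sum_le vc (ltW c0).
Qed.

Definition amp : bop (l2 H) (l2 K) := Bop amp_bounded.

Lemma ampE x n : amp x n = v (x n). Proof. by []. Qed.

End Amp.

Lemma adj_amp H K (v : bop H K) : adj (amp v) = amp (adj v).
Proof.
apply/esym/adjE => x y; rewrite !l2_hdotE /l2dot.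
suff -> : (fun n => hdot (amp v x n) (y n) : C) =
  (fun n => hdot (x n) (amp (adj v) y n)) by [].
by apply/funext => n; rewrite adjP.
Qed.

Lemma amp_comp H K L (v : bop K L) (w : bop H K) :
  amp (v \oB w) = amp v \oB amp w.
Proof. by apply: bopE => x; apply: l2_eqP. Qed.

Lemma ultraweakE H K (v : bop H K) (p : l2pair H K) (x : l2 H) (y : l2 K) :
  (sval p).1 = x -> (sval p).2 = y -> ultraweak_functional v p = hdot (amp v x) y.
Proof. by rewrite /ultraweak_functional => -> ->. Qed.

Section Coord.
Variables (H : hilbertType R) (i : nat).

Lemma l2inj_sum (h : H) n :
  \sum_(0 <= k < n) normsq (if k == i then h else 0) <= normsq h.
Proof.
elim: n => [|n IH]; first by rewrite big_nil normsq_ge0.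
rewrite big_nat_recr //=; have [ni|_] := eqVneq n i; last by rewrite normsq0 addr0.
rewrite big_nat_cond big1 ?add0r// => k /andP[/andP[_ kn] _].
by rewrite ifF ?normsq0// ltn_eqF// -ni.
Qed.

Definition l2inj_fun (h : H) : l2 H := L2 (l2_pred_bound (l2inj_sum h)).

Lemma l2inj_bounded : l2inj_fun \in bounded_op.
Proof.
apply: (@bounded_normsq _ _ _ _ 1) => // [a x y|x].
  by apply: l2_eqP => n; rewrite l2DE l2ZE /=; case: ifP => // _; rewrite scaler0 addr0.
by rewrite mul1r; apply: normsq_bound; exact: l2inj_sum.
Qed.
Definition l2inj : bop H (l2 H) := Bop l2inj_bounded.

Lemma l2injE h n : l2inj h n = if n == i then h else 0. Proof. by []. Qed.

Lemma l2proj_bounded : (fun x : l2 H => x i) \in bounded_op.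
Proof. by apply: (@bounded_normsq _ _ _ _ 1) => // x; rewrite mul1r normsq_coord. Qed.
Definition l2proj : bop (l2 H) H := Bop l2proj_bounded.

Lemma l2projE x : l2proj x = x i. Proof. by []. Qed.

(** Partial sums of the series that defines [<l2inj i h, x>] are eventually equal
    to [<h, x i>]. *)
Lemma adj_l2inj : adj l2inj = l2proj.
Proof.
apply/esym/adjE => h x; rewrite l2_hdotE; apply: l2dot_eq.
apply: (@cvg_near_cst _ _ _ _ _ _); near=> n; rewrite seriesEnat /=.
have ni : (i < n)%N by near: n; exact: nbhs_infty_gt.
rewrite (bigD1_seq i) ?mem_index_iota ?iota_uniq//= eqxx big1 ?addr0// => k ki.
by rewrite (negPf ki) hdot0l.
Unshelve. all: by end_near. Qed.
End Coord.

Lemma amp_inj H K (v : bop H K) i : amp v \oB l2inj H i = l2inj K i \oB v.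
Proof.
apply: bopE => h; apply: l2_eqP => n /=; case: ifP => // _; exact: linear0.
Qed.

Lemma proj_amp H K (v : bop H K) i : l2proj K i \oB amp v = v \oB l2proj H i.
Proof. exact: bopE. Qed.

End Amplification.

(** * Re-indexing a sequence of sequences *)

Section Flattening.
Context {R : realType}.
Local Notation C := (cplx R).
Local Notation Re := complex.Re.
Local Notation Im := complex.Im.
Implicit Types (H K L : hilbertType R).

(** Used in both directions to compare a sum over an initial segment with a sum
    over a rectangle of pairs. *)
Lemma ler_sum_uniq_sub (T : eqType) (s t : seq T) (g : T -> R) :
  (forall x, 0 <= g x) -> uniq s -> {subset s <= t} ->
  \sum_(x <- s) g x <= \sum_(x <- t) g x.
Proof.
move=> g0; elim: s t => [|a s IH] t; first by rewrite big_nil sumr_ge0.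
move=> /= /andP[as_ us] st; have at_ : a \in t by rewrite st ?mem_head.
rewrite big_cons (big_rem a at_) /= lerD2l IH// => y ys.
have : y \in t by rewrite st// inE ys orbT.
rewrite (perm_mem (perm_to_rem at_)) inE => /predU1P[ya|//].
by rewrite -ya ys in as_.
Qed.

Section Flatten.
Variable H : hilbertType R.
Implicit Type x : l2 (l2 H).

(** The pairs of natural numbers are enumerated by [pickle]; an index that codes no
    pair receives the value [0]. *)
Definition flat_seq x (k : nat) : H :=
  oapp (fun p : nat * nat => x p.1 p.2) 0 (pickle_inv k).

Lemma flat_sum_pmap x N : \sum_(0 <= k < N) normsq (flat_seq x k) =
  \sum_(p <- pmap (@pickle_inv (nat * nat)%type) (index_iota 0 N)) normsq (x p.1 p.2).
Proof.
rewrite big_pmap; apply: eq_bigr => k _; rewrite /flat_seq.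
by case: pickle_inv => //=; rewrite normsq0.
Qed.

Lemma flat_sum_le x N : \sum_(0 <= k < N) normsq (flat_seq x k) <= normsq x.
Proof.
rewrite flat_sum_pmap; set S := pmap _ _.
pose B := (\max_(p <- S) maxn p.1 p.2).+1.
have uS : uniq S.
  by apply: (pmap_uniq (@pickle_invK _)); exact: iota_uniq.
have SB : {subset S <= [seq (n, m) | n <- index_iota 0 B, m <- index_iota 0 B]}.
  move=> -[n m] pS.
  have := @leq_bigmax_seq _ S xpredT (fun p => maxn p.1 p.2) _ pS isT.
  rewrite geq_max => /andP[nB mB].
  by apply/allpairsP; exists (n, m); rewrite !mem_index_iota /= !ltnS.
apply: le_trans (ler_sum_uniq_sub _ uS SB) _ => [p|]; first exact: normsq_ge0.
rewrite big_allpairs; apply: le_trans (normsq_partial x B).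
by apply: ler_sum => n _ /=; exact: normsq_partial.
Qed.

Lemma flat_sum_ge x B M : \sum_(0 <= n < B) \sum_(0 <= m < M) normsq (x n m) <=
  \sum_(0 <= k < (\max_(p <- [seq (n, m) | n <- index_iota 0 B, m <- index_iota 0 M])
      pickle p).+1) normsq (flat_seq x k).
Proof.
set S := [seq _ | _ <- _, _ <- _].
rewrite -(@big_allpairs _ _ _ _ _ _ _ (fun p => normsq (x p.1 p.2))) -/S flat_sum_pmap.
apply: ler_sum_uniq_sub => [p||p pS]; first exact: normsq_ge0.
  by apply: allpairs_uniq; rewrite ?iota_uniq// => -[? ?] [? ?] _ _.
rewrite mem_pmap; apply/mapP; exists (pickle p); last by rewrite pickleK_inv.
by rewrite mem_index_iota ltnS /=; exact: (@leq_bigmax_seq _ S xpredT pickle).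
Qed.

Definition flat_fun x : l2 H := L2 (l2_pred_bound (flat_sum_le x)).

(** Every finite set of indices is covered by a rectangle and conversely; the
    inner series are then exhausted simultaneously for finitely many rows. *)
Lemma flat_normsq_fun x : normsq (flat_fun x) = normsq x.
Proof.
apply/eqP; rewrite eq_le; apply/andP; split.
  by apply: normsq_bound; exact: flat_sum_le.
apply: normsq_bound => B; apply/ler_addgt0Pl => e e0.
have [M xM] : exists M, \sum_(0 <= n < B) normsq (x n) <=
    e + \sum_(0 <= n < B) \sum_(0 <= m < M) normsq (x n m).
  have : \forall M \near \oo, \sum_(0 <= n < B) normsq (x n) <=
      e + \sum_(0 <= n < B) \sum_(0 <= m < M) normsq (x n m).
    elim: B e e0 => [|B IH] e e0.
      by near=> M; rewrite !big_nil addr0 ltW.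
    have e2 : 0 < e / 2 by rewrite divr_gt0.
    near=> M; rewrite !big_nat_recr //= [e]splitr addrACA lerD//.
      by near: M; exact: IH.
    near: M; rewrite l2_normsqE /l2normsq l2dot_xx /=.
    have : cvgn (series (fun m => normsq (x B m))).
      apply: (@cvg_series_bound _ (fun m => normsq (x B m)) (normsq (x B))) => n.
        exact: normsq_ge0.
      exact: normsq_partial.
    move/cvgrPdist_le => /(_ _ e2); apply: filterS => m.
    rewrite seriesEnat /= => h; rewrite -lerBlDr.
    exact: le_trans (ler_norm _) h.
  by move=> [M _ /(_ M) h]; exists M; apply: h => /=.
apply: le_trans xM _; rewrite lerD2l; apply: le_trans (flat_sum_ge x B M) _.
exact: normsq_partial (flat_fun x) _.
Unshelve. all: by end_near. Qed.

Lemma flat_bounded : flat_fun \in bounded_op.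
Proof.
apply: (@bounded_normsq _ _ _ _ 1) => // [a x y|x]; last by rewrite mul1r flat_normsq_fun.
apply: l2_eqP => k; rewrite l2DE l2ZE /= /flat_seq.
by case: pickle_inv => //=; rewrite scaler0 addr0.
Qed.
Definition flat : bop (l2 (l2 H)) (l2 H) := Bop flat_bounded.

Lemma flat_normsq x : normsq (flat x) = normsq x. Proof. exact: flat_normsq_fun. Qed.
Lemma flat_hdot x y : hdot (flat x) (flat y) = hdot x y :> C.
Proof. exact: isometry_hdot flat_normsq x y. Qed.
End Flatten.

Lemma flat_amp H K (v : bop H K) x : flat K (amp (amp v) x) = amp v (flat H x).
Proof.
apply: l2_eqP => k; rewrite ampE /= /flat_seq.
by case: pickle_inv => //=; rewrite linear0.
Qed.

(** Isometries of [l2 H] with pairwise orthogonal ranges that commute with every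
    amplification: they combine several sequences into one. *)
Definition shuffle H (i : nat) : bop (l2 H) (l2 H) := flat H \oB l2inj (l2 H) i.

Lemma shuffle_hdot H i j (x y : l2 H) :
  hdot (shuffle H i x) (shuffle H j y) = (if i == j then hdot x y else 0) :> C.
Proof.
rewrite !bop_compE flat_hdot adjPr adj_l2inj l2projE l2injE eq_sym.
by case: ifP; rewrite // hdot0l.
Qed.

Lemma shuffle_amp H K (v : bop H K) i (x : l2 H) :
  amp v (shuffle H i x) = shuffle K i (amp v x).
Proof.
by rewrite /shuffle !bop_compE -flat_amp -[amp (amp v) _]bop_compE amp_inj.
Qed.

End Flattening.

(** * Normal functionals *)

Section NormalFunctional.
Context {R : realType}.
Local Notation C := (cplx R).
Local Notation Re := complex.Re.
Local Notation Im := complex.Im.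
Implicit Types (H K L : hilbertType R).

Lemma bop_appD H K (v : bop H K) x y : v (x + y) = v x + v y.
Proof. exact: linearD. Qed.
Lemma bop_appB H K (v : bop H K) x y : v (x - y) = v x - v y.
Proof. exact: linearB. Qed.
Lemma bop_appZ H K (v : bop H K) (a : C) x : v (a *: x) = a *: v x.
Proof. exact: linearZ. Qed.
Lemma bop_app0 H K (v : bop H K) : v 0 = 0.
Proof. exact: linear0. Qed.

(** An ultraweakly continuous functional is a vector functional of the
    amplification. *)
Definition vec_fun H K (x : l2 H) (y : l2 K) (v : bop H K) : C := hdot (amp v x) y.

Definition normal_fun H K (f : bop H K -> C) : Prop :=
  exists (x : l2 H) (y : l2 K), forall v, f v = vec_fun x y v.

Lemma ultraweak_vec_fun H K (p : l2pair H K) :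
  exists (x : l2 H) (y : l2 K), forall v, ultraweak_functional v p = vec_fun x y v.
Proof.
case: p => -[x y] [/= sx sy].
have x2 : x \in l2_pred by apply/asboolP.
have y2 : y \in l2_pred by apply/asboolP.
by exists (L2 x2), (L2 y2) => v; apply: ultraweakE.
Qed.

Definition l2_pair H K (x : l2 H) (y : l2 K) : l2pair H K :=
  exist _ (l2_fun x, l2_fun y) (conj (@l2_summable _ _ x) (@l2_summable _ _ y)).

Lemma l2_pairE H K (x : l2 H) (y : l2 K) v :
  ultraweak_functional v (l2_pair x y) = vec_fun x y v.
Proof. exact: ultraweakE. Qed.

Lemma vec_fun_linear H K (x : l2 H) (y : l2 K) (a : C) v w :
  vec_fun x y (a *: v + w) = a * vec_fun x y v + vec_fun x y w.
Proof.
rewrite /vec_fun; have -> : amp (a *: v + w) x = a *: amp v x + amp w x.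
  exact: l2_eqP.
by rewrite hdotDl hdotZl.
Qed.

Section NormalFun.
Variables H K : hilbertType R.
Implicit Type f : bop H K -> C.

Lemma normal_fun_linear f : normal_fun f ->
  forall a v w, f (a *: v + w) = a * f v + f w.
Proof. by move=> [x [y fE]] a v w; rewrite !fE vec_fun_linear. Qed.

Lemma normal_fun_eq f g : f =1 g -> normal_fun g -> normal_fun f.
Proof. by move=> fg [x [y gE]]; exists x, y => v; rewrite fg gE. Qed.

Lemma normal_fun0 : normal_fun (fun _ : bop H K => 0).
Proof. by exists 0, 0 => v; rewrite /vec_fun hdot0r. Qed.

(** The two representing sequences are put side by side in one. *)
Lemma normal_funD (a : C) f g : normal_fun f -> normal_fun g ->
  normal_fun (fun v => a * f v + g v).
Proof.
move=> [x [y fE]] [x' [y' gE]].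
exists (shuffle H 0 x + shuffle H 1 x').
exists (Num.conj a *: shuffle K 0 y + shuffle K 1 y') => v.
rewrite fE gE /vec_fun bop_appD !shuffle_amp hdotDl !hdotDr !hdotZr conjCK.
by rewrite !shuffle_hdot /= mulr0 addr0 add0r.
Qed.

(** Both representing sequences are concentrated at index [0]. *)
Lemma normal_fun_dot (h : H) (k : K) : normal_fun (fun v : bop H K => hdot (v h) k).
Proof.
exists (l2inj H 0 h), (l2inj K 0 k) => v.
by rewrite /vec_fun -[amp v _]bop_compE amp_inj bop_compE adjPr adj_l2inj.
Qed.

Lemma normal_fun_vec (x : l2 H) (y : l2 K) : normal_fun (vec_fun x y).
Proof. by exists x, y. Qed.
End NormalFun.

Lemma normal_fun_comp H K H' K' (f : bop H' K' -> C) (a : bop K K') (b : bop H' H) :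
  normal_fun f -> normal_fun (fun v : bop H K => f (a \oB v \oB b)).
Proof.
move=> [x [y fE]]; exists (amp b x), (amp (adj a) y) => v.
by rewrite fE /vec_fun -adj_amp -adjP.
Qed.

Lemma cvg_initial (S : choiceType) (T : topologicalType) (f : S -> T)
    (F : set_system S) {FF : Filter F} (s : S) :
  f @ F --> f s -> F --> (s : initial_topology f).
Proof.
move=> h A /=; rewrite (@nbhsE (initial_topology f)).
move=> -[_ [[B Bop <-] Bs] sBA].
by apply: filterS sBA _; apply: h; exact: open_nbhs_nbhs.
Qed.

Lemma bop_cvg H K (F : set_system (bop H K)) {FF : Filter F} (v : bop H K) :
  (forall (x : l2 H) (y : l2 K), vec_fun x y @ F --> vec_fun x y v) -> F --> v.
Proof.
move=> h; apply: cvg_initial; apply/cvg_sup => p; apply: cvg_initial.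
have [x [y pE]] := ultraweak_vec_fun p.
have := h x y; rewrite (_ : vec_fun x y = fun w => ultraweak_functional w p)//.
by apply/funext => w; rewrite pE.
Qed.

Definition agree H K (s : seq (l2 H * l2 K)) (v w : bop H K) :=
  forall p, p \in s -> vec_fun p.1 p.2 v = vec_fun p.1 p.2 w.

(** The sets containing all operators that agree with [v] on some finite family of
    functionals form a filter that converges to [v], so it contains every
    neighbourhood.  No tolerance is needed: neighbourhoods contain affine subspaces
    of finite codimension, which reduces closure questions to linear algebra. *)
Lemma bop_nbhs H K (v : bop H K) (B : set (bop H K)) : nbhs v B ->
  exists s : seq (l2 H * l2 K), forall w, agree s w v -> B w.
Proof.
pose F : set_system (bop H K) :=
  [set B | exists s : seq (l2 H * l2 K), forall w, agree s w v -> B w].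
have FF : Filter F.
  split; first by exists [::].
  - move=> P Q [s sP] [t tQ]; exists (s ++ t) => w st; split.
      by apply: sP => p ps; apply: st; rewrite mem_cat ps.
    by apply: tQ => p pt; apply: st; rewrite mem_cat pt orbT.
  - by move=> P Q PQ [s sP]; exists s => w /sP /PQ.
suff Fv : F --> v by exact: Fv.
apply: bop_cvg => x y A /nbhs_singleton Av.
by exists [:: (x, y)] => w /(_ (x, y)); rewrite mem_head => /(_ isT) /= ->.
Qed.

Lemma vec_fun_continuous H K (x : l2 H) (y : l2 K) :
  continuous (vec_fun x y : bop H K -> C).
Proof.
have -> : (vec_fun x y : bop H K -> C) = (fun f => f (l2_pair x y)) \o
    (@ultraweak_functional R H K).
  by apply/funext => v /=; rewrite l2_pairE.
move=> v; pose T : topologicalType := prod_topology (fun _ : l2pair H K => C).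
apply: (@cvg_comp _ _ _ (@ultraweak_functional R H K) (fun f : T => f _) _
  (nbhs (@ultraweak_functional R H K v : T))).
  exact: (@initial_continuous (bop H K) T).
have fi : nbhs (@ultraweak_functional R H K v : T) -->
    (@ultraweak_functional R H K v : T) by exact: cvg_id.
move/cvg_sup : fi => /(_ (l2_pair x y)) fi A Ap; apply: fi.
exact: (@initial_continuous (l2pair H K -> C) C (fun f => f (l2_pair x y))) Ap.
Qed.

End NormalFunctional.

(** * The bipolar theorem and spans of products *)

Section Bipolar.
Context {R : realType}.
Local Notation C := (cplx R).
Local Notation Re := complex.Re.
Local Notation Im := complex.Im.
Implicit Types (H K L : hilbertType R).

Lemma vec_fun0 H K (x : l2 H) (y : l2 K) : vec_fun x y (0 : bop H K) = 0.
Proof. by rewrite /vec_fun (_ : amp 0 x = 0) ?hdot0l//; exact: l2_eqP. Qed.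

Lemma subspace_opP H K (V : set (bop H K)) : subspace_op V <->
  V 0 /\ forall a v w, V v -> V w -> V (a *: v + w).
Proof.
split=> [[V0 VP]|[V0 VP]].
  split=> [|a v w Vv Vw]; first exact/set_mem/V0.
  by apply/set_mem/VP; exact/mem_set.
split; first exact/mem_set.
by move=> a v w /set_mem Vv /set_mem Vw; apply/mem_set/VP.
Qed.

Lemma subspace_kernel H K (A : set (bop H K)) x y : subspace_op A ->
  subspace_op (A `&` [set v | vec_fun x y v = 0]).
Proof.
move=> /subspace_opP[A0 AP]; apply/subspace_opP; split=> [|a v w [Av v0] [Aw w0]].
  by split=> //=; exact: vec_fun0.
by split=> /=; [exact: AP|rewrite vec_fun_linear v0 w0 mulr0 addr0].
Qed.

(** Either the functional vanishes on [A], or [A] is the direct sum of its kernel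
    in [A] and a line. *)
Lemma subspace_split H K (A : set (bop H K)) x y : subspace_op A ->
  (forall v, A v -> vec_fun x y v = 0) \/
  exists2 e, A e /\ vec_fun x y e = 1 &
    forall v, A v -> (A `&` [set v | vec_fun x y v = 0]) (- vec_fun x y v *: e + v).
Proof.
move=> /subspace_opP[A0 AP].
have [h|/existsNP[v /not_implyP[Av /eqP v0]]] :=
  pselect (forall v, A v -> vec_fun x y v = 0); first by left.
have e1 : vec_fun x y ((vec_fun x y v)^-1 *: v) = 1.
  have := vec_fun_linear x y (vec_fun x y v)^-1 v 0.
  by rewrite vec_fun0 !addr0 mulVf.
have Ae : A ((vec_fun x y v)^-1 *: v) by rewrite -[_ *: _]addr0; exact: AP.
right; exists ((vec_fun x y v)^-1 *: v) => // w Aw; split; first exact: AP.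
by rewrite /= vec_fun_linear e1 mulr1 addNr.
Qed.

Definition annihilates H K (f : bop H K -> C) (A : set (bop H K)) :=
  forall v, A v -> f v = 0.

(** Induction on the number of functionals: when the first one does not vanish on
    [A], its value is adjusted along a line and the others are treated inside its
    kernel, where the hypothesis on [v] persists. *)
Lemma bipolar_agree H K (s : seq (l2 H * l2 K)) (A : set (bop H K)) v :
  subspace_op A -> (forall f, normal_fun f -> annihilates f A -> f v = 0) ->
  exists2 w, A w & agree s w v.
Proof.
elim: s A v => [|[x y] s IH] A v sA hA.
  by exists 0 => //; case/subspace_opP: sA.
have [A0 AP] := (subspace_opP A).1 sA.
have [h|[e [Ae e1] eP]] := subspace_split x y sA.
  have [w Aw sw] := IH A v sA hA; exists w => // p; rewrite inE => /predU1P[->|/sw//].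
  by rewrite /= h// hA//; exact: normal_fun_vec.
have [|w [Aw w0] sw] :=
    IH _ (- vec_fun x y v *: e + v) (subspace_kernel x y sA).
  move=> f nf fA; have fv := normal_fun_linear nf.
  rewrite fv -[RHS](hA _ (normal_funD (- f e) (normal_fun_vec x y) nf)) /=; first ring.
  by move=> u /eP /fA; rewrite fv => <-; ring.
exists (vec_fun x y v *: e + w); first exact: AP.
move=> p; rewrite inE => /predU1P[->|ps] /=.
  by rewrite vec_fun_linear e1 w0 addr0 mulr1.
by rewrite vec_fun_linear sw// vec_fun_linear; ring.
Qed.

(** A linear functional vanishing on a finite intersection of kernels is a linear
    combination of the functionals; here on a subspace [A] only. *)
Lemma normal_fun_extend H K (s : seq (l2 H * l2 K)) (A : set (bop H K))
    (phi : bop H K -> C) : subspace_op A ->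
  (forall a v w, A v -> A w -> phi (a *: v + w) = a * phi v + phi w) ->
  (forall v, A v -> agree s v 0 -> phi v = 0) ->
  exists2 f, normal_fun f & forall v, A v -> phi v = f v.
Proof.
elim: s A phi => [|[x y] s IH] A phi sA phiL phi0.
  by exists (fun _ => 0); [exact: normal_fun0|move=> v Av; exact: phi0].
have [A0 AP] := (subspace_opP A).1 sA.
have [h|[e [Ae e1] eP]] := subspace_split x y sA.
  apply: (IH A phi sA phiL) => v Av vs; apply: phi0 => // p.
  by rewrite inE => /predU1P[->|/vs//]; rewrite /= h// vec_fun0.
have [||f nf fE] := IH _ phi (subspace_kernel x y sA).
- by move=> a v w [Av _] [Aw _]; exact: phiL.
- move=> v [Av v0] vs; apply: phi0 => // p.
  by rewrite inE => /predU1P[->|/vs//]; rewrite /= v0 vec_fun0.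
exists (fun v => (phi e - f e) * vec_fun x y v + f v).
  by apply: normal_funD => //; exact: normal_fun_vec.
move=> v Av; have := fE _ (eP v Av); rewrite phiL// (normal_fun_linear nf) => h.
by transitivity (- vec_fun x y v * phi e + phi v + vec_fun x y v * phi e);
  [ring|rewrite h; ring].
Qed.

Lemma closure_bipolar H K (A : set (bop H K)) v : subspace_op A ->
  closure A v <-> forall f, normal_fun f -> annihilates f A -> f v = 0.
Proof.
move=> sA; split=> [cA f [x [y fE]] fA|h].
  have cl : closed (vec_fun x y @^-1` [set (0 : C)]).
    apply: closed_comp => [w _|]; first exact: vec_fun_continuous.
    exact: accessible_closed_set1 (hausdorff_accessible (@norm_hausdorff _ _)) _.
  rewrite fE; apply: cl; apply: closure_subset cA => w Aw /=.
  by rewrite -fE fA.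
move=> B /bop_nbhs[s sB].
have [w Aw ws] := bipolar_agree s sA h; exists w; split=> //; exact: sB.
Qed.

Lemma closed_bipolar H K (A : set (bop H K)) : subspace_op A ->
  (forall v, (forall f, normal_fun f -> annihilates f A -> f v = 0) -> A v) ->
  closed A.
Proof. by move=> sA h v /(closure_bipolar v sA) /h. Qed.

Lemma closed_mem H K (A : set (bop H K)) v : subspace_op A -> closed A ->
  (forall f, normal_fun f -> annihilates f A -> f v = 0) -> A v.
Proof. by move=> sA cA h; apply: cA; exact/(closure_bipolar v sA). Qed.

Lemma smallest_subspace H K (G : set (bop H K)) :
  subspace_op (smallest (@subspace_op _ H K) G).
Proof.
apply/subspace_opP; split=> [A [/subspace_opP[A0 _] _]//|a v w sv sw A sA].
by have [/subspace_opP[_ AP] _] := sA; apply: AP; [exact: sv|exact: sw].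
Qed.

Lemma annihilates_smallest H K (G : set (bop H K)) f : normal_fun f ->
  annihilates f G -> annihilates f (smallest (@subspace_op _ H K) G).
Proof.
move=> nf fG; have [x [y fE]] := nf.
move=> v sv; apply: (sv [set v | f v = 0]); split=> //.
apply/subspace_opP; split=> [|a u w u0 w0].
  by rewrite /= fE vec_fun0.
by rewrite /= (normal_fun_linear nf) u0 w0 mulr0 addr0.
Qed.

(** The closure of a span is the bipolar of its generators, here of the products. *)
Lemma prod_opP H K L (V : set (bop K L)) (W : set (bop H K)) x :
  prod_op V W x <-> forall f, normal_fun f ->
    (forall v w, V v -> W w -> f (v \oB w) = 0) -> f x = 0.
Proof.
rewrite /prod_op closure_bipolar; last exact: smallest_subspace.
split=> h f nf fVW; apply: h => //.
  by apply: annihilates_smallest => // _ [v Vv [w Ww <-]]; exact: fVW.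
by move=> v w Vv Ww; apply: fVW => A [_]; apply; exists v => //; exists w.
Qed.

Lemma prod_op_comp H K L (V : set (bop K L)) (W : set (bop H K)) v w :
  V v -> W w -> prod_op V W (v \oB w).
Proof. by move=> Vv Ww; apply/prod_opP => f _; exact. Qed.

Lemma prod_op_sub H K L (V : set (bop K L)) (W : set (bop H K)) X :
  subspace_op X -> closed X -> (forall v w, V v -> W w -> X (v \oB w)) ->
  prod_op V W `<=` X.
Proof.
move=> sX cX VW x /prod_opP h; apply: closed_mem => // f nf fX; apply: h => //.
by move=> v w Vv Ww; apply: fX; exact: VW.
Qed.

Lemma normal_funl H K K' (f : bop H K' -> C) (a : bop K K') :
  normal_fun f -> normal_fun (fun v : bop H K => f (a \oB v)).
Proof.
move=> nf; apply: normal_fun_eq (normal_fun_comp a (bop1 H) nf) => v.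
by rewrite bop_comp1.
Qed.

Lemma normal_funr H K H' (f : bop H' K -> C) (b : bop H' H) :
  normal_fun f -> normal_fun (fun v : bop H K => f (v \oB b)).
Proof.
move=> nf; apply: normal_fun_eq (normal_fun_comp (bop1 K) b nf) => v.
by rewrite bop_1comp.
Qed.

End Bipolar.

(** * Ultraweakly continuous maps *)

Section NormalMap.
Context {R : realType}.
Local Notation C := (cplx R).
Local Notation Re := complex.Re.
Local Notation Im := complex.Im.
Implicit Types (H K L : hilbertType R).

Definition to_set_type (T : choiceType) (A : set T) (x : T) (Ax : A x) : A :=
  exist _ x (mem_set Ax).

Lemma set_val_to_set_type (T : choiceType) (A : set T) (x : T) (Ax : A x) :
  set_val (to_set_type Ax) = x.
Proof. by []. Qed.

Lemma set_val_inj (T : choiceType) (A : set T) : injective (@set_val T A).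
Proof. by move=> a b; exact: val_inj. Qed.

Lemma set_val_mem (T : choiceType) (A : set T) (a : A) : A (set_val a).
Proof. by case: a => a aA; exact: set_mem aA. Qed.

Section Pullback.
Variables (H K : hilbertType R) (N : set (bop K K)) (M : set (bop H H)).
Variable pi : N -> M.

(** Continuity at [0] makes [f \o pi] bounded by [1] on the common kernel of
    finitely many normal functionals.  This kernel is a subspace, so [f \o pi]
    vanishes on it and is therefore a combination of these functionals. *)
Lemma normal_fun_pullback f : subspace_op N ->
  (forall (c : cplx R) (a b d : N), set_val d = c *: set_val a + set_val b ->
    set_val (pi d) = c *: set_val (pi a) + set_val (pi b)) ->
  continuous pi -> normal_fun f ->
  exists2 g, normal_fun g & forall b : N, f (set_val (pi b)) = g (set_val b).
Proof.
move=> sN piL pic nf; have [N0 NP] := (subspace_opP N).1 sN.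
pose z : N := to_set_type N0.
pose phi b := f (set_val (pi (insubd z b))).
have phiE (b : N) : phi (set_val b) = f (set_val (pi b)).
  congr (f (set_val (pi _))); apply: set_val_inj.
  by rewrite set_valE insubdK//; apply/mem_set; rewrite -set_valE; exact: set_val_mem.
have phiL a v w : N v -> N w -> phi (a *: v + w) = a * phi v + phi w.
  move=> Nv Nw; rewrite -[v](set_val_to_set_type Nv) -[w](set_val_to_set_type Nw).
  rewrite -[_ + _](set_val_to_set_type (NP a _ _ Nv Nw)) !phiE -(normal_fun_linear nf).
  by rewrite (piL a (to_set_type Nv) (to_set_type Nw)).
have [s sP] : exists s, forall v, N v -> agree s v 0 -> `|phi v| < 1.
  have [x [y fE]] := nf.
  have piz : f (set_val (pi z)) = 0.
    have := phiL 0 0 0 N0 N0; rewrite scale0r add0r mul0r add0r.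
    have := phiL 1 0 0 N0 N0; rewrite scale1r add0r mul1r (phiE z).
    by move=> /eqP; rewrite -[X in X == _]addr0 (inj_eq (addrI _)) eq_sym => /eqP.
  have zc : (fun b : N => f (set_val (pi b))) @ z --> f (set_val (pi z)).
    apply: (@cvg_comp _ _ _ pi (fun m : M => f (set_val m)) _ (nbhs (pi z))).
      exact: pic.
    apply: (@cvg_comp _ _ _ (@set_val _ M) f _ (nbhs (set_val (pi z)))).
      exact: initial_continuous.
    by rewrite (_ : f = vec_fun x y); [exact: vec_fun_continuous|exact/funext].
  move: zc; rewrite piz => /cvgr0_norm_lt /(_ 1 ltr01).
  rewrite near_simpl /= => -[_ [[B Bop <-] Bz] sB].
  have [s sP] := bop_nbhs (open_nbhs_nbhs (conj Bop Bz)).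
  exists s => v Nv vs; rewrite -[v](set_val_to_set_type Nv) phiE.
  by apply: sB; apply: sP.
have [|g ng gE] := normal_fun_extend sN phiL (s := s).
  move=> v Nv vs; apply/eqP; apply: contraT => p0.
  have Nw : N ((phi v)^-1 *: v) by rewrite -[_ *: _]addr0; exact: NP.
  have := sP _ Nw; rewrite -[_ *: _]addr0 phiL// mulVf// => h.
  have phi0 : phi 0 = 0.
    have := phiL 1 0 0 N0 N0; rewrite scale1r add0r mul1r.
    by move=> /eqP; rewrite -[X in X == _]addr0 (inj_eq (addrI _)) eq_sym => /eqP.
  move: h; rewrite phi0 [1 + 0]addr0 normr1 ltxx; apply => p ps.
  by rewrite vec_fun_linear (vs p ps) !vec_fun0 mulr0 addr0.
by exists g => // b; rewrite -phiE gE//; exact: set_val_mem.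
Qed.

Lemma continuous_normal_fun :
  (forall f, normal_fun f ->
    exists2 g, normal_fun g & forall b : N, f (set_val (pi b)) = g (set_val b)) ->
  continuous pi.
Proof.
move=> h b; pose T : topologicalType := N : Type.
have FF : Filter (nbhs (b : T)) by exact: nbhs_filter.
have FM : Filter (pi @ nbhs (b : T)) by exact: fmap_filter.
apply: (@cvg_initial _ _ (@set_val _ M)).
apply: bop_cvg => x y; have [g [x' [y' gE]] fg] := h _ (normal_fun_vec x y).
rewrite fg gE.
have c : (fun b : N => vec_fun x' y' (set_val b)) @ b --> vec_fun x' y' (set_val b).
  apply: (@cvg_comp _ _ _ (@set_val _ N) (vec_fun x' y') _ (nbhs (set_val b))).
    exact: initial_continuous.
  exact: vec_fun_continuous.
move=> A /c; apply: (@filterS _ _ FF) => b' /=.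
by rewrite fg gE.
Qed.
End Pullback.

End NormalMap.

(** * The bicommutant theorem *)

Section Bicommutant.
Context {R : realType}.
Local Notation C := (cplx R).
Local Notation Re := complex.Re.
Local Notation Im := complex.Im.
Implicit Types (H K L : hilbertType R).

(** Operators on [l2] are determined by their matrix entries; comparing adjoints
    avoids any density argument. *)
Lemma bop_l2_eqP H K (T U : bop (l2 H) (l2 K)) :
  (forall i j, l2proj K i \oB T \oB l2inj H j = l2proj K i \oB U \oB l2inj H j) ->
  T = U.
Proof.
move=> TU.
have TU0 j h : T (l2inj H j h) = U (l2inj H j h).
  apply: l2_eqP => i; rewrite -!l2projE -!(bop_compE (l2proj K i)).
  by rewrite -!(bop_compE _ (l2inj H j)) TU.
have aTU z : adj T z = adj U z.
  apply: l2_eqP => j; apply: hdot_inj => h.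
  by rewrite -!l2projE -!adj_l2inj -!adjP TU0.
by apply: bopE => y; apply: hdot_inj => z; rewrite !adjPr aTU.
Qed.

(** By the bipolar theorem it is enough that [<amp x xi, eta> = 0] whenever [eta] is
    orthogonal to all [amp a xi].  Let [P] be the projection onto the closure of
    these vectors.  It commutes with each [amp a], so its matrix entries lie in
    the commutant of [A], and [x] commutes with them; hence [amp x] commutes with
    [P].  The absence of a common kernel gives [P xi = xi], so that [amp x xi] is
    in the range of [P]. *)
Theorem bicommutant_closure H (A : set (bop H H)) : subspace_op A ->
  (forall a b, A a -> A b -> A (a \oB b)) -> (forall a, A a -> A (adj a)) ->
  (forall h, (forall a, A a -> a h = 0) -> h = 0) ->
  commutant (commutant A) `<=` closure A.
Proof.
move=> sA Ac Aa A0 x xA; apply/(closure_bipolar x sA) => f [xi [eta fE]] fA.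
have [A00 AP] := (subspace_opP A).1 sA.
pose S := [set p : l2 H * l2 H | exists2 a, A a & p = (amp a xi, amp a xi)].
have Ss : rel_subspace S.
  split=> [|c _ _ [a Aa' ->] [b Ab ->]].
    by exists 0 => //; congr (_, _); exact: l2_eqP.
  by exists (c *: a + b); [exact: AP|congr (_, _); exact: l2_eqP].
have [|P [PE PO]] := bounded_rel_adjoint Ss (@ltr01 R).
  by move=> _ [a _ ->]; rewrite mul1r.
pose D := fst @` S.
have AS a : A a -> S (amp a xi, amp a xi) by move=> Aa'; exists a.
have AD a : A a -> D (amp a xi) by move=> Aa'; exists (amp a xi, amp a xi) => //; exact: AS.
have Pd a y : A a -> hdot (amp a xi) (P y) = hdot (amp a xi) y :> C.
  by move=> /AS /PE ->.
(* Moving amp a across the inner product keeps D and its orthogonal invariant. *)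
have adjm a b y : hdot (amp b xi) (amp a y) = hdot (amp (adj a \oB b) xi) y :> C.
  by rewrite adjPr adj_amp amp_comp.
have oD a z : A a -> orth D z -> orth D (amp a z).
  by move=> Aa' oz _ [_ [b Ab ->] <-] /=; rewrite adjm oz//; apply: AD; apply: Ac; auto.
have ooD a z : A a -> orth (orth D) z -> orth (orth D) (amp a z).
  by move=> Aa' oz d od; rewrite adjPr adj_amp oz//; apply: oD => //; auto.
have Pcomm a : A a -> P \oB amp a = amp a \oB P.
  move=> Aa'; apply: bopE => y; apply: (@orth_orth_eq _ _ D).
  - exact: PO.
  - by apply: ooD => //; exact: PO.
  - by move=> _ [_ [b Ab ->] <-] /=; rewrite Pd// !adjm Pd//; apply: Ac; auto.
have Pfix a : A a -> P (amp a xi) = amp a xi.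
  move=> Aa'; apply: (@orth_orth_eq _ _ D); first exact: PO.
    by move=> d dD; rewrite hdotC dD ?conjC0//; exact: AD.
  by move=> _ [_ [b Ab ->] <-] /=; exact: Pd.
pose Pij i j := l2proj H i \oB P \oB l2inj H j.
have Pijc i j : commutant A (Pij i j).
  move=> a Aa'; rewrite /Pij bop_compA -amp_inj -!bop_compA -proj_amp.
  by rewrite (bop_compA _ P) Pcomm// -bop_compA.
have xPij i j : x \oB Pij i j = Pij i j \oB x by exact: xA.
have xP : amp x \oB P = P \oB amp x.
  apply: bop_l2_eqP => i j.
  rewrite -[X in X \oB _ = _]bop_compA proj_amp !bop_compA amp_inj.
  by have := xPij i j; rewrite /Pij !bop_compA.
have Pxi : P xi = xi.
  apply/esym/eqP; rewrite -subr_eq0; apply/eqP/l2_eqP => n.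
  apply: A0 => a Aa'; rewrite -ampE bop_appB -[amp a (P xi)]bop_compE -Pcomm//.
  by rewrite bop_compE Pfix// subrr.
rewrite fE /vec_fun -Pxi -[amp x _]bop_compE xP bop_compE hdotC.
rewrite (PO _ eta) ?conjC0// => _ [_ [a Aa' ->] <-] /=.
by have := fA a Aa'; rewrite fE.
Qed.

End Bicommutant.

(** * Normal representations and their intertwiners *)

Section Representation.
Context {R : realType}.
Local Notation C := (cplx R).
Local Notation Re := complex.Re.
Local Notation Im := complex.Im.
Implicit Types (H K L : hilbertType R).

Lemma hdot_injl H (x y : H) : (forall z, hdot x z = hdot y z :> C) -> x = y.
Proof. by move=> xy; apply: hdot_inj => z; rewrite [LHS]hdotC xy -hdotC. Qed.

Lemma adjoint_setE H K (V : set (bop H K)) w : adjoint_set V w <-> V (adj w).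
Proof.
split=> [[v Vv /adjE ->]|Vw]; first by rewrite adjK.
by exists (adj w) => // x y; rewrite adjP adjK.
Qed.

Lemma vn_adj H (M : set (bop H H)) a : von_neumann M -> M a -> M (adj a).
Proof. by move=> vM Ma; apply: (vn_adjoint vM); apply/adjoint_setE; rewrite adjK. Qed.

Section Span.
Variables (H : hilbertType R) (G : set (bop H H)).
Let A := smallest (@subspace_op _ H H) G.

Lemma span_ind (P : set (bop H H)) : subspace_op P -> G `<=` P -> A `<=` P.
Proof. by move=> sP GP a Aa; apply: (Aa P). Qed.

Lemma span_gen a : G a -> A a.
Proof. by move=> Ga P [_]; exact. Qed.

Lemma span_comp : (forall a b, G a -> G b -> G (a \oB b)) ->
  forall a b, A a -> A b -> A (a \oB b).
Proof.
move=> GG; have [A0 AP] := (subspace_opP A).1 (smallest_subspace G).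
suff h b : G b -> forall a, A a -> A (a \oB b).
  move=> a b Aa; apply: (span_ind (P := [set b | A (a \oB b)])).
    apply/subspace_opP; split=> [|c v w /= Av Aw] /=; first by rewrite bop_comp0.
    by rewrite bop_comp_linearr; exact: AP.
  by move=> g Gg; exact: h.
move=> Gb; apply: (span_ind (P := [set a | A (a \oB b)])).
  apply/subspace_opP; split=> [|c v w /= Av Aw] /=; first by rewrite bop_0comp.
  by rewrite bop_comp_linearl; exact: AP.
by move=> a Ga; apply: span_gen; exact: GG.
Qed.

Lemma span_adj : (forall a, G a -> G (adj a)) -> forall a, A a -> A (adj a).
Proof.
move=> GG; have [A0 AP] := (subspace_opP A).1 (smallest_subspace G).
apply: (span_ind (P := [set a | A (adj a)])).
  apply/subspace_opP; split=> [|c v w /= Av Aw] /=; first by rewrite adj0.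
  by rewrite adj_linear; exact: AP.
by move=> a Ga; apply: span_gen; exact: GG.
Qed.
End Span.

(** The ternary product makes the span of the operators [adj v \oB w] a selfadjoint
    algebra, to which the bicommutant theorem applies. *)
Lemma one_in_prod_op H K (V : set (bop H K)) :
  (forall u v w, V u -> V v -> V w -> V (u \oB adj v \oB w)) ->
  (forall h, (forall v, V v -> v h = 0) -> h = 0) ->
  prod_op (adjoint_set V) V (bop1 H).
Proof.
move=> V3 V0; pose G := [set v \oB w | v in adjoint_set V & w in V].
have GE a : G a <-> exists v w, [/\ V v, V w & a = adj v \oB w].
  split=> [[v /adjoint_setE Vv [w Vw <-]]|[v [w [Vv Vw ->]]]].
    by exists (adj v), w; rewrite adjK.
  by exists (adj v); [apply/adjoint_setE; rewrite adjK|exists w].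
apply: (@bicommutant_closure _ H (smallest (@subspace_op _ H H) G)).
- exact: smallest_subspace.
- apply: span_comp => a b /GE[v [w [Vv Vw ->]]] /GE[v' [w' [Vv' Vw' ->]]].
  apply/GE; exists v, (w \oB adj v' \oB w'); split=> //; first exact: V3.
  by rewrite !bop_compA.
- apply: span_adj => a /GE[v [w [Vv Vw ->]]].
  by apply/GE; exists w, v; rewrite adj_comp adjK.
- move=> h hA; apply: V0 => v Vv; apply: hdot_eq0.
  rewrite adjP -bop_compE hA ?hdot0r//; apply: span_gen; apply/GE.
  by exists v, v.
- by move=> m _; rewrite bop_comp1 bop_1comp.
Qed.

(** Normal homomorphisms as total functions, of which only the values on [N] count;
    normality is expressed by functionals instead of the topology. *)
Record normal_rep H K (N : set (bop K K)) (rho : bop K K -> bop H H) : Prop := {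
  rep_lin : forall (c : C) a b, N a -> N b ->
    rho (c *: a + b) = c *: rho a + rho b ;
  rep_mul : forall a b, N a -> N b -> rho (a \oB b) = rho a \oB rho b ;
  rep_one : rho (bop1 K) = bop1 H ;
  rep_adj : forall a, N a -> rho (adj a) = adj (rho a) ;
  rep_normal : forall f, normal_fun f ->
    exists2 g, normal_fun g & forall b, N b -> f (rho b) = g b
}.

Definition intertwiners H K (N : set (bop K K)) (rho : bop K K -> bop H H) :
    set (bop H K) :=
  [set v | forall b, N b -> b \oB v = v \oB rho b].

Section Intertwiners.
Variables (H K : hilbertType R) (N : set (bop K K)) (rho : bop K K -> bop H H).
Hypothesis vN : von_neumann N.
Let V := intertwiners N rho.

Lemma intertwiners_subspace : subspace_op V.
Proof.
apply/subspace_opP; split=> [b Nb|a v w Vv Vw b Nb].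
  by rewrite bop_comp0 bop_0comp.
by rewrite bop_comp_linearr bop_comp_linearl Vv// Vw.
Qed.

Lemma intertwiners_closed : closed V.
Proof.
apply: (closed_bipolar intertwiners_subspace) => v h b Nb.
apply: bopE => x; apply: hdot_injl => y; apply/eqP.
rewrite -subr_eq0 !bop_compE; apply/eqP.
have nf : normal_fun (fun v : bop H K => -1 * hdot (v (rho b x)) y + hdot (v x) (adj b y)).
  by apply: normal_funD; exact: normal_fun_dot.
rewrite adjP addrC -mulN1r; apply: (h _ nf) => w Vw.
by rewrite -adjP -!bop_compE Vw// mulN1r addNr.
Qed.

Hypothesis rN : normal_rep N rho.

(** The adjoint of the intertwining relation for [adj b]. *)
Lemma intertwiners_adj v b : V v -> N b -> rho b \oB adj v = adj v \oB b.
Proof.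
move=> Vv Nb; have Nb' := vn_adj vN Nb.
have := Vv _ Nb' => /(congr1 (@adj R _ _)).
by rewrite !adj_comp (rep_adj rN)// !adjK => ->.
Qed.

Lemma intertwiners_triple u v w : V u -> V v -> V w -> V (u \oB adj v \oB w).
Proof.
move=> Vu Vv Vw b Nb.
rewrite -!bop_compA Vu// (bop_compA u) intertwiners_adj// -bop_compA.
by rewrite (bop_compA _ b) Vw// -bop_compA.
Qed.

(** Apply normality to the functional of the vector [h] and polarise: [rho b h] is
    dominated by [amp b z] for a single [z] in [l2 K].  The coordinates of the
    adjoint [T] of the map [amp b z |-> rho b h] are intertwiners, and
    [<z, T h> = <h, h>]. *)
Lemma intertwiners_nondegenerate h : (forall v, V v -> v h = 0) -> h = 0.
Proof.
move=> h0; have [N0 NP] := (subspace_opP N).1 (vn_subspace vN).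
have N1 := vn_unit vN.
have [g [xi [eta gE]] fg] := rep_normal rN (normal_fun_dot h h).
pose z := xi + eta.
pose S := [set p : l2 K * H | exists2 b, N b & p = (amp b z, rho b h)].
have rho0 : rho 0 = 0.
  have := rep_lin rN (-1) N0 N0; rewrite scaler0 addr0.
  by rewrite scaleN1r addNr.
have ampD a b c : amp (c *: a + b) z = c *: amp a z + amp b z by exact: l2_eqP.
have Ss : rel_subspace S.
  split=> [|c _ _ [a Na ->] [b Nb ->]].
    by exists 0; rewrite // rho0; congr (_, _); exact: l2_eqP.
  by exists (c *: a + b); [exact: NP|rewrite ampD (rep_lin rN)].
have [|T [TE TO]] := bounded_rel_adjoint Ss (@ltr01 R).
  move=> _ [b Nb ->].
  suff : normsq (rho b h) <= normsq (amp b z) by rewrite mul1r.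
  have -> : normsq (rho b h) = rdot (amp b xi) (amp b eta).
    have Nb' := vn_adj vN Nb; have Nbb := vn_comp vN Nb' Nb.
    rewrite /normsq !rdotE adjPr -(rep_adj rN Nb) -bop_compE -(rep_mul rN)//.
    by rewrite fg// gE /vec_fun amp_comp bop_compE -adj_amp -adjPr.
  have := normsq_ge0 (amp b xi - amp b eta); have := normsq_ge0 (amp b xi + amp b eta).
  rewrite normsqB normsqD /z bop_appD normsqD; lra.
have Tz b y : N b -> hdot (amp b z) (T y) = hdot (rho b h) y :> C.
  by move=> Nb; rewrite (TE (amp b z, rho b h))//; exists b.
pose D := fst @` S.
have adjm a b (y : l2 K) : hdot (amp b z) (amp a y) = hdot (amp (adj a \oB b) z) y :> C.
  by rewrite adjPr adj_amp amp_comp.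
have oD a y : N a -> orth D y -> orth D (amp a y).
  move=> Na oy _ [_ [b Nb ->] <-] /=; rewrite adjm oy//.
  exists (amp (adj a \oB b) z, rho (adj a \oB b) h) => //.
  by exists (adj a \oB b) => //; apply: (vn_comp vN) => //; exact: vn_adj.
have ooD a y : N a -> orth (orth D) y -> orth (orth D) (amp a y).
  by move=> Na oy d od; rewrite adjPr adj_amp oy//; apply: oD => //; exact: vn_adj.
have Tint b : N b -> amp b \oB T = T \oB rho b.
  move=> Nb; apply: bopE => y; apply: (@orth_orth_eq _ _ D).
  - by apply: ooD => //; exact: TO.
  - exact: TO.
  move=> _ [_ [c Nc ->] <-] /=; have Nb' := vn_adj vN Nb.
  rewrite adjm Tz//; last exact: (vn_comp vN).
  by rewrite Tz// (rep_mul rN)// (rep_adj rN)// adjPr.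
have Th : T h = 0.
  apply: l2_eqP => n; rewrite -l2projE -bop_compE; apply: h0 => b Nb.
  by rewrite -bop_compA -proj_amp !bop_compA Tint.
by apply: hdot_eq0; have := Tz _ h N1; rewrite Th hdot0r (rep_one rN) => <-.
Qed.

Lemma intertwiners_one : prod_op (adjoint_set V) V (bop1 H).
Proof.
apply: one_in_prod_op; first exact: intertwiners_triple.
exact: intertwiners_nondegenerate.
Qed.
End Intertwiners.

End Representation.

(** * Operators defined through their intertwiners *)

Section Transport.
Context {R : realType}.
Local Notation C := (cplx R).
Local Notation Re := complex.Re.
Local Notation Im := complex.Im.
Implicit Types (H K L : hilbertType R).

Lemma bernoulli (q : R) n : 0 <= q -> 1 + n%:R * q <= (1 + q) ^+ n.
Proof.
move=> q0; elim: n => [|n IH]; first by rewrite mul0r addr0 expr0.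
rewrite exprS; apply: (@le_trans _ _ ((1 + q) * (1 + n%:R * q))); last first.
  by rewrite ler_wpM2l// addr_ge0.
have : 0 <= n%:R * q * q by rewrite !mulr_ge0.
by rewrite -natr1; nra.
Qed.

Lemma geometric_bound (p0 r D M : R) : 0 < p0 -> 0 < D ->
  (forall n, r ^+ n * p0 <= M * D ^+ n) -> r <= D.
Proof.
move=> p00 D0 h; rewrite leNgt; apply/negP => Dr.
pose q := r / D - 1.
have q0 : 0 < q by rewrite subr_gt0 ltr_pdivlMr// mul1r.
have hn n : n%:R <= M / p0 / q.
  rewrite ler_pdivlMr// ler_pdivlMr//.
  apply: (@le_trans _ _ ((1 + q) ^+ n * p0)).
    by rewrite ler_pM2r// (le_trans _ (bernoulli n (ltW q0)))// lerDr.
  rewrite addrCA subrr addr0 expr_div_n mulrAC ler_pdivrMr ?exprn_gt0//.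
have := hn (Num.truncn (M / p0 / q)).+1.
by rewrite leNgt truncnS_gt.
Qed.

(** Cauchy--Schwarz and the shift identity make [normsq (U m)] logarithmically
    convex; if its first ratio exceeded [D], it would grow faster than [D ^ m]. *)
Lemma moment_growth H (U : nat -> H) (D M : R) : 0 < D ->
  (forall m n, rdot (U m.+1) (U n) = rdot (U m) (U n.+1)) ->
  (forall m, normsq (U m) <= M * D ^+ m) -> normsq (U 1) <= D * normsq (U 0).
Proof.
move=> D0 Us UM; rewrite leNgt; apply/negP => h.
have cvx m : normsq (U m.+1) ^+ 2 <= normsq (U m) * normsq (U m.+2).
  by apply: le_trans (rdot_CS _ _); rewrite -Us.
have p00 : 0 < normsq (U 0).
  rewrite lt_neqAle normsq_ge0 andbT eq_sym; apply/eqP => p0.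
  move: h (cvx 0); rewrite p0 mulr0 mul0r => h.
  by rewrite leNgt exprn_gt0.
pose r := normsq (U 1) / normsq (U 0).
have Dr : D < r by rewrite ltr_pdivlMr.
have r0 : 0 < r := lt_trans D0 Dr.
have hr m : 0 < normsq (U m) /\ r * normsq (U m) <= normsq (U m.+1).
  elim: m => [|m [pm IH]]; first by rewrite divfK ?lt0r_neq0.
  have pm1 : 0 < normsq (U m.+1) by apply: lt_le_trans IH; rewrite mulr_gt0.
  split=> //; rewrite -(ler_pM2l pm); apply: le_trans (cvx m).
  by rewrite mulrA (mulrC _ r) expr2 ler_pM2r.
have hm m : r ^+ m * normsq (U 0) <= M * D ^+ m.
  apply: le_trans (UM m); elim: m => [|m IH]; first by rewrite mul1r.
  by rewrite exprS -mulrA; apply: le_trans (hr m).2; rewrite ler_pM2l.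
by have := geometric_bound p00 D0 hm; rewrite leNgt Dr.
Qed.

Lemma hdot_sumr H I (s : seq I) (F : I -> H) (y : H) :
  hdot y (\sum_(i <- s) F i) = \sum_(i <- s) (hdot y (F i) : C).
Proof.
elim: s => [|i s IH]; first by rewrite !big_nil hdot0r.
by rewrite !big_cons hdotDr IH.
Qed.

Section Implement.
Variables (H K : hilbertType R) (N : set (bop K K)) (V : set (bop H K)).
Hypothesis Nadj : forall b, N b -> N (adj b).
Hypothesis VN : forall b v w, N b -> V v -> V w ->
  b \oB (v \oB adj w) = (v \oB adj w) \oB b.

Definition adj_sum_in (s : seq (bop H K * K)) := forall p, p \in s -> V p.1.
(** The value at a formal sum of pairs [(v, k)] of the map that sends [adj v k] to
    [adj v (g k)]. *)
Definition adj_sum (s : seq (bop H K * K)) (g : bop K K) : H :=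
  \sum_(p <- s) adj p.1 (g p.2).

(** Since [v \oB adj w] commutes with [adj g], the operator [g] moves to the other
    side of the inner product. *)
Lemma adj_sum_move s g h h' : adj_sum_in s -> N g ->
  hdot (adj_sum s (g \oB h)) (adj_sum s h') =
  hdot (adj_sum s h) (adj_sum s (adj g \oB h')) :> C.
Proof.
move=> sV Ng; rewrite /adj_sum hdot_suml [RHS]hdot_suml.
apply: eq_big_seq => p ps; rewrite !hdot_sumr.
apply: eq_big_seq => q qs; rewrite adjP adjK [RHS]adjP adjK !bop_compE adjP.
have e := congr1 (fun T : bop K K => T (h' q.2))
  (VN (Nadj Ng) (sV p ps) (sV q qs)).
by rewrite !bop_compE in e; rewrite e.
Qed.

Lemma adj_sum_bound s : exists2 M : R, 0 <= M & forall (g : bop K K) (E : R), 0 <= E ->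
  (forall y, normsq (g y) <= E * normsq y) -> normsq (adj_sum s g) <= M * E.
Proof.
rewrite /adj_sum; elim: s => [|p s [M M0 IH]].
  by exists 0 => // g E _ _; rewrite big_nil normsq0 mul0r.
have [c c0 vc] := bop_bounded (adj p.1).
exists (2 * (c * normsq p.2) + 2 * M).
  by rewrite addr_ge0// !mulr_ge0 ?normsq_ge0// ltW.
move=> g E E0 gE; rewrite big_cons; apply: le_trans (normsqD_le _ _) _.
rewrite [leRHS]mulrDl lerD//.
  rewrite -mulrA ler_pM2l// (le_trans (vc _))// -mulrA ler_pM2l//.
  by rewrite mulrC.
by rewrite -mulrA ler_pM2l//; exact: IH.
Qed.

(** With [c = b \oB adj b], the vectors [adj_sum s c^n] satisfy the hypotheses of
    [moment_growth]. *)
Lemma adj_sum_adj_le (b : bop K K) (D : R) s : 0 < D ->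
  (forall y, normsq (b (adj b y)) <= D * normsq y) ->
  N b -> N (b \oB adj b) -> adj_sum_in s ->
  normsq (adj_sum s (adj b)) <= (D + 1) * normsq (adj_sum s (bop1 K)).
Proof.
move=> D0 bD Nb Nc sV; pose c := b \oB adj b.
have cc : adj c = c by rewrite /c adj_comp adjK.
pose cn n : bop K K := iter n (bop_comp c) (bop1 K).
have [M M0 sM] := adj_sum_bound s.
have cnD n y : normsq (cn n y) <= D ^+ n * normsq y.
  elim: n => [|n IH]; first by rewrite mul1r.
  rewrite exprS -mulrA; apply: le_trans (bD _) _.
  by rewrite ler_pM2l.
have h1 : normsq (adj_sum s (cn 1%N)) <= D * normsq (adj_sum s (cn 0%N)).
  apply: (moment_growth (U := fun n => adj_sum s (cn n)) (M := M)) => // [m n|m].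
    by rewrite !rdotE (adj_sum_move _ _ sV Nc) cc.
  by apply: sM => //; rewrite exprn_ge0// ltW.
have h2 : normsq (adj_sum s (adj b)) = rdot (adj_sum s (cn 1%N)) (adj_sum s (cn 0%N)).
  rewrite /normsq !rdotE; have -> : cn 1%N = b \oB adj b by rewrite /cn /= bop_comp1.
  by rewrite (adj_sum_move _ _ sV Nb) bop_comp1.
(* Cauchy-Schwarz turns the estimate for c into one for adj b. *)
have h3 := rdot_CS (adj_sum s (cn 1%N)) (adj_sum s (cn 0%N)).
rewrite -h2 in h3; have q0 := normsq_ge0 (adj_sum s (cn 0%N)).
rewrite -/(cn 0%N) -(@ler_pXn2r _ 2) ?nnegrE ?normsq_ge0 ?mulr_ge0//; last first.
  by rewrite addr_ge0// ltW.
apply: le_trans h3 _; apply: (@le_trans _ _ (D * normsq (adj_sum s (cn 0%N)) ^+ 2)).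
  by rewrite expr2 mulrA ler_wpM2r.
rewrite exprMn ler_wpM2r ?sqr_ge0//; nra.
Qed.

(** The relation sending [\sum adj v k] to [\sum adj v (adj b k)] is bounded by
    [adj_sum_adj_le], in particular single-valued; [x] is its adjoint. *)
Lemma intertwined_exists b : N b -> N (b \oB adj b) ->
  exists x : bop H H, forall v, V v -> v \oB x = b \oB v.
Proof.
move=> Nb Nc.
pose S := [set p : H * H | exists2 s, adj_sum_in s &
  p = (adj_sum s (bop1 K), adj_sum s (adj b))].
have Ss : rel_subspace S.
  split=> [|a _ _ [s sV ->] [t tV ->]].
    by exists [::] => //; rewrite /adj_sum !big_nil.
  exists ([seq (p.1, a *: p.2) | p <- s] ++ t).
    move=> p; rewrite mem_cat => /orP[/mapP[q qs ->]/=|/tV//].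
    exact: sV.
  have tE g : adj_sum ([seq (p.1, a *: p.2) | p <- s] ++ t) g = a *: adj_sum s g + adj_sum t g.
    rewrite /adj_sum big_cat big_map scaler_sumr; congr (_ + _).
    by apply: eq_bigr => p _; rewrite !bop_appZ.
  by rewrite /= !tE.
have [D D0 bD] := bop_bounded (b \oB adj b).
have D1 : 0 < D + 1 by rewrite addr_gt0.
have [|T [TE _]] := bounded_rel_adjoint Ss D1.
  by move=> _ [s sV ->]; exact: adj_sum_adj_le.
exists T => v Vv; apply: bopE => y; apply: hdot_inj => k.
have := TE (adj v k, adj v (adj b k)) y; rewrite /= !adjP !adjK; apply.
exists [:: (v, k)]; first by move=> p; rewrite inE => /eqP ->.
by rewrite /adj_sum !big_seq1.
Qed.
End Implement.

End Transport.

(** * Domination by square-summable sequences *)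

Section Domination.
Context {R : realType}.
Local Notation C := (cplx R).
Local Notation Re := complex.Re.
Local Notation Im := complex.Im.
Implicit Types (H K L : hilbertType R).

Lemma normsq_shuffle H (x y : l2 H) :
  normsq (shuffle H 0 x + shuffle H 1 y) = normsq x + normsq y.
Proof.
rewrite normsqD !rdotE shuffle_hdot /= mulr0 addr0 /normsq !rdotE.
by rewrite !shuffle_hdot.
Qed.

Section Kaczmarz.
Variables (H K : hilbertType R) (W : bop H K).
Hypothesis W1 : forall x, normsq (W x) <= normsq x.

(** A relaxation step in the sense of Kaczmarz: for contractive [W] it decreases the
    square norm by at least [normsq (W x)] and by at most twice that amount. *)
Definition relax (x : H) : H := x - adj W (W x).

Let W1' y : normsq (adj W y) <= normsq y.
Proof.
rewrite -[leRHS]mul1r; apply: adj_bound => // x; rewrite mul1r; exact: W1.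
Qed.

Lemma normsq_relax x :
  normsq (relax x) = normsq x - 2 * normsq (W x) + normsq (adj W (W x)).
Proof. by rewrite /relax normsqB -rdot_adj. Qed.

Lemma normsq_relax_le x : normsq (relax x) <= normsq x - normsq (W x).
Proof. by rewrite normsq_relax; have := W1' (W x); lra. Qed.

Lemma normsq_relax_ge x : normsq x <= normsq (relax x) + 2 * normsq (W x).
Proof. by rewrite normsq_relax; have := normsq_ge0 (adj W (W x)); lra. Qed.

Lemma iter_relaxB n x y :
  iter n relax (x - y) = iter n relax x - iter n relax y.
Proof.
elim: n => //= n ->; rewrite /relax !bop_appB !opprB [LHS]addrACA [RHS]addrACA.
by congr (_ + _); exact: addrC.
Qed.

Lemma normsq_iter_relax n x : normsq (iter n relax x) <= normsq x.
Proof.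
elim: n => //= n IH; apply: le_trans (normsq_relax_le _) _.
by have := normsq_ge0 (W (iter n relax x)); lra.
Qed.
End Kaczmarz.

(** The iterates equal [adj W (y n)], where [y] iterates the relaxation of
    [adj W]; the quantities [normsq (adj W (y n))] decrease, and their sum is at
    most [normsq k]. *)
Lemma relax_decay H K (W : bop H K) k n : (forall x, normsq (W x) <= normsq x) ->
  n.+1%:R * normsq (iter n (relax W) (adj W k)) <= normsq k.
Proof.
move=> W1.
have aW1 y : normsq (adj W y) <= normsq y.
  rewrite -[leRHS]mul1r; apply: adj_bound => // x; rewrite mul1r; exact: W1.
pose y n := iter n (relax (adj W)) k.
have yE m : iter m (relax W) (adj W k) = adj W (y m).
  elim: m => //= m ->; rewrite /y /= -/(y m) /relax adjK bop_appB//.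
have dec m : normsq (adj W (y m.+1)) <= normsq (adj W (y m)).
  rewrite -!yE /=; apply: le_trans (normsq_relax_le W1 _) _.
  by rewrite gerBl normsq_ge0.
suff h m : normsq (y m.+1) + m.+1%:R * normsq (adj W (y m)) <= normsq k.
  by rewrite yE; apply: le_trans (h n); rewrite lerDr normsq_ge0.
elim: m => [|m IH].
  by have := normsq_relax_le aW1 k; rewrite mul1r /y /=; lra.
have := normsq_relax_le aW1 (y m.+1); rewrite -[relax _ _]/(y m.+2) => h.
have {}dec : m.+1%:R * normsq (adj W (y m.+1)) <= m.+1%:R * normsq (adj W (y m)).
  by rewrite ler_wpM2l.
apply: le_trans IH; rewrite -natr1 mulrDl mul1r.
move: (_ * _) (_ * _) dec h => a b; lra.
Qed.

Section DominationLemmas.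
Variables (H K : hilbertType R) (N : set (bop K K)) (rho : bop K K -> bop H H).
Hypothesis Nadj : forall b, N b -> N (adj b).
Hypothesis rho_adj : forall b, N b -> rho (adj b) = adj (rho b).
Hypothesis V0 : forall h, (forall v, intertwiners N rho v -> v h = 0) -> h = 0.

Definition l2_intertwiner (W : bop H (l2 K)) :=
  forall b, N b -> amp b \oB W = W \oB rho b.

Lemma l2_intertwiner_adj W b : l2_intertwiner W -> N b ->
  rho b \oB adj W = adj W \oB amp b.
Proof.
move=> WI Nb; have := WI _ (Nadj Nb) => /(congr1 (@adj R _ _)).
by rewrite !adj_comp adj_amp rho_adj// !adjK => ->.
Qed.

(** [Z] accounts for the passage from [xi] to [xi'], simultaneously in norm and for
    the action of every [b]. *)
Definition absorbed (xi xi' : H) (Z : l2 K) : Prop :=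
  normsq Z <= normsq xi - normsq xi' /\
  forall b, N b -> normsq (rho b xi) <= normsq (rho b xi') + 2 * normsq (amp b Z).

Lemma absorbed_refl xi : absorbed xi xi 0.
Proof.
by split=> [|b _]; rewrite ?bop_app0 normsq0 ?subrr// mulr0 addr0.
Qed.

Lemma absorbed_trans xi xi' xi'' Z Z' : absorbed xi xi' Z -> absorbed xi' xi'' Z' ->
  absorbed xi xi'' (shuffle K 0 Z + shuffle K 1 Z').
Proof.
move=> [h1 h2] [h1' h2']; split=> [|b Nb].
  by rewrite normsq_shuffle; move: h1 h1'; lra.
rewrite bop_appD !shuffle_amp normsq_shuffle.
by have := h2 b Nb; have := h2' b Nb; lra.
Qed.

Lemma absorbed_relax W xi : l2_intertwiner W -> (forall x, normsq (W x) <= normsq x) ->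
  absorbed xi (relax W xi) (W xi).
Proof.
move=> WI W1; split=> [|b Nb].
  by have := normsq_relax_le W1 xi; lra.
have -> : rho b (relax W xi) = relax W (rho b xi).
  rewrite /relax bop_appB -(bop_compE (rho b)) l2_intertwiner_adj// bop_compE.
  by rewrite -(bop_compE (amp b)) WI.
rewrite -(bop_compE (amp b)) WI//; exact: normsq_relax_ge.
Qed.

Lemma absorbed_iter W xi n : l2_intertwiner W -> (forall x, normsq (W x) <= normsq x) ->
  exists Z, absorbed xi (iter n (relax W) xi) Z.
Proof.
move=> WI W1; elim: n => [|n [Z hZ]]; first by exists 0; exact: absorbed_refl.
eexists; apply: absorbed_trans hZ _; exact: absorbed_relax.
Qed.

(** The vectors [adj W k] form a subspace, since two intertwiners into [l2 K] are
    combined into one by [shuffle]; its orthogonal is the common kernel, which is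
    zero.  Scaling makes [W] contractive. *)
Lemma l2_intertwiner_dense xi (e : R) : 0 < e ->
  exists W k, [/\ l2_intertwiner W, forall x, normsq (W x) <= normsq x &
    normsq (xi - adj W k) < e].
Proof.
move=> e0.
pose S := [set p : H * H | exists W k, l2_intertwiner W /\ p = (adj W k, adj W k)].
have Ss : rel_subspace S.
  split=> [|a _ _ [W [k [WI ->]]] [W' [k' [WI' ->]]]].
    exists 0, 0; split; last by rewrite bop_app0.
    by move=> b _; rewrite bop_comp0 bop_0comp.
  exists (shuffle K 0 \oB W + shuffle K 1 \oB W').
  exists (a *: shuffle K 0 k + shuffle K 1 k'); split.
    move=> b Nb; apply: bopE => x; rewrite !bop_compE !bopDE !bop_compE.
    rewrite bop_appD !shuffle_amp -!(bop_compE (amp b)).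
    by rewrite WI// WI'.
  suff aE : adj (shuffle K 0 \oB W + shuffle K 1 \oB W')
      (a *: shuffle K 0 k + shuffle K 1 k') = a *: adj W k + adj W' k'.
    by rewrite /= aE.
  apply: hdot_inj => z; rewrite -adjP bopDE !bop_compE hdotDl !hdotDr !hdotZr.
  by rewrite !shuffle_hdot /= mulr0 addr0 add0r !adjP.
have [|z [zE zc]] := riesz_relation xi Ss _ (@ltr01 R).
  by move=> _ [W [k [_ ->]]] /=; rewrite mul1r.
have zxi : z = xi.
  apply/eqP; rewrite -subr_eq0; apply/eqP/V0 => v vI.
  have WI : l2_intertwiner (l2inj K 0 \oB v).
    by move=> b Nb; rewrite -bop_compA amp_inj !bop_compA vI.
  have WE k : hdot (adj (l2inj K 0 \oB v) k) z = hdot (adj (l2inj K 0 \oB v) k) xi :> C.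
    have Sk : S (adj (l2inj K 0 \oB v) k, adj (l2inj K 0 \oB v) k).
      by exists (l2inj K 0 \oB v), k.
    exact: zE Sk.
  have : (l2inj K 0 \oB v) (z - xi) = 0.
    apply: hdot_inj => k; rewrite hdot0r bop_appB hdotBr !adjPr WE subrr//.
  by move=> /(congr1 (l2proj K 0)); rewrite bop_app0.
have [_ [W [k [WI ->]]] /= zW] := zc e e0.
have [c c0 Wc] := bop_bounded W.
have c1 : 0 < 1 + c by rewrite addr_gt0.
(* Dividing by 1 + c makes W contractive since c <= (1 + c) ^ 2; k takes the factor. *)
pose r : C := (((1 + c)^-1)%:C)%C.
exists (r *: W), (((1 + c)%:C)%C *: k); split.
- by move=> b Nb; have := bop_comp_linearr r W 0 (amp b); rewrite !addr0 bop_comp0 addr0 => ->;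
    rewrite WI//; apply: bopE.
- move=> x; rewrite bopZE normsqZr.
  apply: (@le_trans _ _ ((1 + c)^-1 ^+ 2 * (c * normsq x))).
    by rewrite ler_wpM2l// sqr_ge0.
  rewrite mulrA ler_piMl ?normsq_ge0// exprVn mulrC ler_pdivrMr ?exprn_gt0// mul1r.
  nra.
- have -> : adj (r *: W) (((1 + c)%:C)%C *: k) = adj W k; last by rewrite -zxi.
  apply: hdot_inj => w; rewrite -adjP hdotZr bopZE hdotZl adjP mulrA.
  suff -> : Num.conj ((1 + c)%:C%C : C) * r = 1 by rewrite mul1r.
  have -> : Num.conj ((1 + c)%:C%C : C) = (1 + c)%:C%C by exact: conjc_real.
  by rewrite -(rmorphM (real_complex R)) divff// lt0r_neq0.
Qed.

(** Approximate [xi] by some [adj W k].  The iterated relaxation contracts the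
    error and sends [adj W k] to [0] by [relax_decay]. *)
Lemma absorbed_half xi : exists xi' Z, absorbed xi xi' Z /\ normsq xi' <= normsq xi / 2.
Proof.
have := normsq_ge0 xi; rewrite le_eqVlt => /predU1P[x0|x0].
  by exists xi, 0; split; [exact: absorbed_refl|rewrite -x0 mul0r].
have e0 : 0 < normsq xi / 8 by rewrite divr_gt0.
have [W [k [WI W1 Wk]]] := l2_intertwiner_dense xi e0.
pose n := Num.truncn (8 * normsq k / normsq xi).
have [Z hZ] := absorbed_iter xi n WI W1; exists (iter n (relax W) xi), Z; split=> //.
have -> : iter n (relax W) xi =
    iter n (relax W) (xi - adj W k) + iter n (relax W) (adj W k).
  by rewrite iter_relaxB subrK.
have h1 := normsq_iter_relax W1 n (xi - adj W k).
have h2 := relax_decay k n W1.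
have h3 : normsq (iter n (relax W) (adj W k)) <= normsq xi / 8.
  have n0 : 0 < n.+1%:R :> R by [].
  rewrite -(ler_pM2l n0); apply: le_trans h2 _.
  have : 8 * normsq k / normsq xi < n.+1%:R by exact: truncnS_gt.
  by rewrite ltr_pdivrMr// => /ltW; move: (n.+1%:R) => a; lra.
apply: le_trans (normsqD_le _ _) _; move: h1 h3 Wk.
by move: (normsq (iter _ _ _)) (normsq (iter _ _ _)) (normsq (xi - _)) => *; lra.
Qed.

(** Halve [xi] infinitely often; the absorbed vectors are square-summable because
    their square norms telescope, and [flat] turns them into one sequence. *)
Lemma domination xi : exists Z : l2 K, forall b, N b ->
  normsq (rho b xi) <= 2 * normsq (amp b Z).
Proof.
have /choice[F /choice[G FG]] := absorbed_half.
pose x n := iter n F xi; pose Z n := G (x n).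
have xn n : normsq (x n) <= normsq xi / 2 ^+ n.
  elim: n => [|n IH]; first by rewrite divr1.
  apply: le_trans (FG (x n)).2 _; rewrite exprSr invfM mulrA.
  by rewrite ler_pM2r.
have sZ n : \sum_(0 <= i < n) normsq (Z i) <= normsq xi - normsq (x n).
  elim: n => [|n IH]; first by rewrite big_nil subrr.
  by rewrite big_nat_recr //=; have := (FG (x n)).1.1; move: IH; rewrite /Z /=; lra.
have sZ' n : \sum_(0 <= i < n) normsq (Z i) <= normsq xi.
  by apply: le_trans (sZ n) _; rewrite gerBl normsq_ge0.
pose ZZ : l2 (l2 K) := L2 (l2_pred_bound sZ').
exists (flat K ZZ) => b Nb; rewrite -flat_amp flat_normsq.
have hb n : normsq (rho b xi) <= normsq (rho b (x n)) +
    2 * \sum_(0 <= i < n) normsq (amp (amp b) ZZ i).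
  elim: n => [|n IH]; first by rewrite big_nil mulr0 addr0.
  rewrite big_nat_recr //=; have := (FG (x n)).1.2 b Nb; move: IH.
  rewrite -/(Z n) -[F (x n)]/(x n.+1); move: (\sum_(_ <= _ < _) _) => s; lra.
have [c c0 rc] := bop_bounded (rho b).
apply/ler_addgt0Pl => e e0.
pose n := Num.truncn (c * normsq xi / e).
apply: le_trans (hb n) _; rewrite lerD//; last first.
  by rewrite ler_pM2l// normsq_partial.
apply: le_trans (rc _) _.
apply: (@le_trans _ _ (c * (normsq xi / 2 ^+ n))); first by rewrite ler_pM2l.
rewrite mulrA ler_pdivrMr ?exprn_gt0//.
have : c * normsq xi / e < n.+1%:R by exact: truncnS_gt.
rewrite ltr_pdivrMr// => h; apply: le_trans (ltW h) _.
rewrite mulrC ler_pM2l//; have := @bernoulli R 1 n ler01.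
by rewrite mulr1 -natr1 addrC.
Qed.
End DominationLemmas.

End Domination.

(** * Quantum functions *)

Section QuantumFunction.
Context {R : realType}.
Local Notation C := (cplx R).
Local Notation Re := complex.Re.
Local Notation Im := complex.Im.
Implicit Types (H K L : hilbertType R).

(** Apply [domination] to the amplified map [amp (rho b)] and the vector [xi]:
    [amp b Z |-> amp (rho b) xi] is bounded, and its adjoint moves the functional
    given by [xi] and [eta] to one on [N]. *)
Lemma normal_of_nondegenerate H K (N : set (bop K K)) (rho : bop K K -> bop H H) :
  von_neumann N ->
  (forall (c : C) a b, N a -> N b -> rho (c *: a + b) = c *: rho a + rho b) ->
  (forall b, N b -> rho (adj b) = adj (rho b)) ->
  (forall h, (forall v, intertwiners N rho v -> v h = 0) -> h = 0) ->
  forall f, normal_fun f ->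
    exists2 g, normal_fun g & forall b, N b -> f (rho b) = g b.
Proof.
move=> vN rl ra V0 f [xi [eta fE]].
have [N0 NP] := (subspace_opP N).1 (vn_subspace vN).
have Na b : N b -> N (adj b) by exact: vn_adj.
have ra' b : N b -> amp (rho (adj b)) = adj (amp (rho b)).
  by move=> Nb; rewrite adj_amp ra.
have V0' x : (forall v, intertwiners N (fun b => amp (rho b)) v -> v x = 0) -> x = 0.
  move=> h; apply: l2_eqP => n; apply: V0 => v vI.
  have := h (v \oB l2proj H n); apply=> b Nb.
  by rewrite bop_compA proj_amp -!bop_compA vI.
have [Z Zb] := domination Na ra' V0' xi.
pose S := [set p : l2 K * l2 H | exists2 b, N b & p = (amp b Z, amp (rho b) xi)].
have rho0 : rho 0 = 0.
  have := rl (-1) _ _ N0 N0; rewrite scaler0 addr0.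
  by rewrite scaleN1r addNr.
have Ss : rel_subspace S.
  split=> [|c _ _ [a Nb ->] [b Nb' ->]].
    by exists 0; rewrite // rho0; congr (_, _); exact: l2_eqP.
  exists (c *: a + b); first exact: NP.
  by rewrite rl//; congr (_, _); exact: l2_eqP.
have [|T [TE _]] := bounded_rel_adjoint Ss (ltr0n R 2).
  by move=> _ [b Nb ->]; exact: Zb.
exists (vec_fun Z (T eta)); first exact: normal_fun_vec.
by move=> b Nb; rewrite fE /vec_fun (TE (amp b Z, amp (rho b) xi))//; exists b.
Qed.

Section Conversion.
Variables (H K : hilbertType R) (N : set (bop K K)) (M : set (bop H H)).
Hypothesis vN : von_neumann N.

Lemma graph_intertwiners (pi : N -> M) (rho : bop K K -> bop H H) :
  (forall b : N, rho (set_val b) = set_val (pi b)) ->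
  graph pi = intertwiners N rho.
Proof.
move=> rhoE; apply/seteqP; split=> [v vG b Nb|v vI b].
  by have := vG (to_set_type Nb); rewrite -rhoE set_val_to_set_type.
by rewrite -rhoE; apply: vI; exact: set_val_mem.
Qed.

Lemma rep_of_hom (pi : N -> M) : normal_hom pi ->
  exists2 rho, normal_rep N rho & forall b : N, rho (set_val b) = set_val (pi b).
Proof.
move=> hpi; have [N0 NP] := (subspace_opP N).1 (vn_subspace vN).
pose rho b := set_val (pi (insubd (to_set_type N0) b)).
have rhoE (b : N) : rho (set_val b) = set_val (pi b).
  congr (set_val (pi _)); apply: set_val_inj.
  by rewrite set_valE insubdK//; apply/mem_set; rewrite -set_valE; exact: set_val_mem.
have rhoS b (Nb : N b) : rho b = set_val (pi (to_set_type Nb)) by rewrite -rhoE.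
exists rho => //; split.
- move=> c a b Na Nb; rewrite (rhoS _ (NP c _ _ Na Nb)) (rhoS _ Na) (rhoS _ Nb).
  exact: (hom_linear hpi).
- move=> a b Na Nb; rewrite (rhoS _ (vn_comp vN Na Nb)) (rhoS _ Na) (rhoS _ Nb).
  exact: (hom_mul hpi).
- by rewrite (rhoS _ (vn_unit vN)); exact: (hom_unit hpi).
- move=> a Na; rewrite (rhoS _ (vn_adj vN Na)) (rhoS _ Na).
  by apply: adjE; apply: (hom_adjoint hpi) => x y; rewrite adjP.
- move=> f nf; have [g ng gE] := normal_fun_pullback (vn_subspace vN)
    (hom_linear hpi) (hom_normal hpi) nf.
  by exists g => // b Nb; rewrite (rhoS _ Nb) gE.
Qed.

Lemma hom_of_rep (rho : bop K K -> bop H H) : normal_rep N rho ->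
  (forall b, N b -> M (rho b)) ->
  exists2 pi : N -> M, normal_hom pi & forall b : N, rho (set_val b) = set_val (pi b).
Proof.
move=> rN rM; pose pi (b : N) : M := to_set_type (rM _ (set_val_mem b)).
have piE (b : N) : set_val (pi b) = rho (set_val b) by [].
exists pi => //; split.
- move=> c a b d dE; rewrite !piE dE (rep_lin rN)//; exact: set_val_mem.
- move=> a b d dE; rewrite !piE dE (rep_mul rN)//; exact: set_val_mem.
- by move=> a aE; rewrite piE aE (rep_one rN).
- move=> a b /adjE bE x y; rewrite !piE bE (rep_adj rN) ?adjP//; exact: set_val_mem.
- apply: continuous_normal_fun => f nf.
  have [g ng gE] := rep_normal rN nf.
  by exists g => // b; rewrite piE gE//; exact: set_val_mem.
Qed.
End Conversion.

(** In this form the commutant inherits the closedness of spaces of intertwiners. *)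
Lemma commutant_intertwiners H (M : set (bop H H)) :
  commutant M = intertwiners M id.
Proof. by apply/seteqP; split=> v vI m Mm; rewrite vI. Qed.

Section RepQuantumFunction.
Variables (H K : hilbertType R) (N : set (bop K K)) (M : set (bop H H)).
Variable rho : bop K K -> bop H H.
Hypotheses (vN : von_neumann N) (rN : normal_rep N rho).
Hypothesis rM : forall b, N b -> M (rho b).
Let V := intertwiners N rho.

Lemma intertwiners_commutantr v m : V v -> commutant M m -> V (v \oB m).
Proof.
by move=> Vv Mm b Nb; rewrite -bop_compA Vv// !bop_compA Mm//; exact: rM.
Qed.

Lemma intertwiners_commutantl n v : commutant N n -> V v -> V (n \oB v).
Proof. by move=> Nn Vv b Nb; rewrite -bop_compA -Nn// !bop_compA Vv. Qed.

(** Totality comes from the identity in [adj(V) V], multiplied by the commutant of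
    [M]; the other axioms are formal. *)
Lemma intertwiners_quantum_function : quantum_function M N V.
Proof.
have sV : subspace_op V := intertwiners_subspace N rho.
have cV : closed V := @intertwiners_closed _ _ _ N rho.
split; first split=> //.
- apply: prod_op_sub => // x m xP Mm; apply: intertwiners_commutantr => //.
  by apply: (prod_op_sub sV cV _ xP) => n v; exact: intertwiners_commutantl.
- move=> m Mm; apply/prod_opP => f nf fVV.
  have /prod_opP/(_ _ (normal_funr m nf)) := intertwiners_one vN rN.
  rewrite bop_1comp; apply=> v w Vv Vw; rewrite bop_compA; apply: fVV => //.
  exact: intertwiners_commutantr.
- rewrite commutant_intertwiners; apply: prod_op_sub.
  + exact: intertwiners_subspace.
  + exact: intertwiners_closed.
  move=> v w Vv /adjoint_setE Vw b Nb.
  have := intertwiners_adj vN rN Vw Nb; rewrite adjK => e.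
  by rewrite -bop_compA Vv// bop_compA e bop_compA.
Qed.
End RepQuantumFunction.

Section QuantumFunctionRep.
Variables (H K : hilbertType R) (N : set (bop K K)) (M : set (bop H H)).
Variable V : set (bop H K).
Hypotheses (vN : von_neumann N) (vM : von_neumann M).
Hypothesis qV : quantum_function M N V.

Lemma qfun_commutantlr n v m : commutant N n -> V v -> commutant M m ->
  V (n \oB v \oB m).
Proof.
move=> Nn Vv Mm; apply: (qrel_bimodule (qfun_relation qV)).
by apply: prod_op_comp => //; exact: prod_op_comp.
Qed.

Lemma commutant1 L (A : set (bop L L)) : commutant A (bop1 L).
Proof. by move=> m _; rewrite bop_comp1 bop_1comp. Qed.

Lemma qfun_commutantr v m : V v -> commutant M m -> V (v \oB m).
Proof.
by move=> Vv Mm; have := qfun_commutantlr (@commutant1 _ N) Vv Mm; rewrite bop_1comp.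
Qed.

Lemma qfun_commutantl n v : commutant N n -> V v -> V (n \oB v).
Proof.
by move=> Nn Vv; have := qfun_commutantlr Nn Vv (@commutant1 _ M); rewrite bop_comp1.
Qed.

Lemma qfun_adj v w : V v -> V w -> commutant N (v \oB adj w).
Proof.
move=> Vv Vw; apply: (qfun_functional qV); apply: prod_op_comp => //.
by apply/adjoint_setE; rewrite adjK.
Qed.

Lemma qfun_one : prod_op (adjoint_set V) V (bop1 H).
Proof. by apply: (qfun_total qV); exact: commutant1. Qed.

(** A common kernel would be killed by [adj(V) V], which contains the identity. *)
Lemma qfun_nondegenerate h : (forall v, V v -> v h = 0) -> h = 0.
Proof.
move=> h0; apply: hdot_eq0.
have /prod_opP/(_ _ (normal_fun_dot h h)) := qfun_one; apply.
by move=> v w _ Vw; rewrite bop_compE h0// bop_app0 hdot0l.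
Qed.

Lemma qfun_inj L (x y : bop L H) : (forall v, V v -> v \oB x = v \oB y) -> x = y.
Proof.
move=> xy; apply: bopE => h; apply/eqP; rewrite -subr_eq0; apply/eqP.
apply: qfun_nondegenerate => v Vv.
by rewrite bop_appB -!bop_compE xy// subrr.
Qed.

(** The relations [v \oB rho b = b \oB v] determine [rho b], and every algebraic
    property is checked after composition with [v].  An intertwiner [u] of [rho]
    lies in the closed span of the operators [u adj(v) w], where [u adj(v)]
    commutes with [N], so it belongs to [V]. *)
Lemma qfun_rep : exists rho, [/\ normal_rep N rho, forall b, N b -> M (rho b) &
  V = intertwiners N rho].
Proof.
have Na b : N b -> N (adj b) by exact: vn_adj.
have VN b v w : N b -> V v -> V w -> b \oB (v \oB adj w) = (v \oB adj w) \oB b.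
  by move=> Nb Vv Vw; rewrite (qfun_adj Vv Vw Nb).
have /choice[rho rhoP] : forall b, exists x : bop H H,
    N b -> forall v, V v -> v \oB x = b \oB v.
  move=> b; have [Nb|] := pselect (N b); last by exists 0.
  have [|x xP] := intertwined_exists Na VN Nb; first by apply: (vn_comp vN) => //; exact: Na.
  by exists x.
have rV b v : N b -> V v -> v \oB rho b = b \oB v by move=> Nb; exact: rhoP.
have [N0 NP] := (subspace_opP N).1 (vn_subspace vN).
have rl (c : C) a b : N a -> N b -> rho (c *: a + b) = c *: rho a + rho b.
  move=> Na' Nb; apply: qfun_inj => v Vv.
  by rewrite rV ?bop_comp_linearr ?bop_comp_linearl ?rV//; exact: NP.
have rVa b v : N b -> V v -> rho b \oB adj v = adj v \oB b.
  move=> Nb Vv; apply: qfun_inj => w Vw.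
  by rewrite -!bop_compA rV// bop_compA VN.
have ra b : N b -> rho (adj b) = adj (rho b).
  move=> Nb; apply: qfun_inj => v Vv; rewrite rV//; last exact: Na.
  have := congr1 (@adj R _ _) (rVa b v Nb Vv).
  by rewrite !adj_comp !adjK.
have VI : V `<=` intertwiners N rho by move=> v Vv b Nb; rewrite rV.
exists rho; split.
- split=> //.
  + move=> a b Na' Nb; apply: qfun_inj => v Vv.
    rewrite rV//; last exact: (vn_comp vN).
    by rewrite -[RHS]bop_compA [v \oB _]rV// [RHS]bop_compA rV// bop_compA.
  + apply: qfun_inj => v Vv; rewrite rV//; last exact: (vn_unit vN).
    by rewrite bop_1comp bop_comp1.
  + apply: normal_of_nondegenerate => // h h0.
    by apply: qfun_nondegenerate => v /VI; exact: h0.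
- move=> b Nb; apply: (vn_closed vM); apply: bicommutant_closure.
  + exact: (vn_subspace vM).
  + exact: (vn_comp vM).
  + by move=> a; exact: vn_adj.
  + by move=> h /(_ (bop1 H) (vn_unit vM)).
  move=> m Mm; apply: qfun_inj => v Vv.
  by rewrite -!bop_compA !rV// ?bop_compA//; exact: qfun_commutantr.
- apply/seteqP; split=> // u uI.
  have sV := qrel_subspace (qfun_relation qV).
  apply: (closed_mem sV (qrel_closed (qfun_relation qV))) => f nf fV.
  have /prod_opP/(_ _ (normal_funl u nf)) := qfun_one.
  rewrite bop_comp1; apply=> v w /adjoint_setE Vv Vw; apply: fV.
  rewrite -bop_compA; apply: qfun_commutantl => // b Nb.
  have := rVa b _ Nb Vv; rewrite adjK => e.
  by rewrite bop_compA -e -!bop_compA uI.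
Qed.
End QuantumFunctionRep.

End QuantumFunction.

(** * The correspondence *)

Theorem mainTheorem1 (R : realType) :
  (forall (H K : hilbertType R) (M : set (bop H H)) (N : set (bop K K)),
     von_neumann M -> von_neumann N ->
     set_bij [set pi : N -> M | normal_hom pi]
             [set V : set (bop H K) | quantum_function M N V]
             (fun pi => graph pi))
  /\ (forall (H : hilbertType R) (M : set (bop H H)),
        von_neumann M -> graph (fun a : M => a) = commutant M)
  /\ (forall (H0 H1 H2 : hilbertType R) (M0 : set (bop H0 H0))
        (M1 : set (bop H1 H1)) (M2 : set (bop H2 H2))
        (pi1 : M2 -> M1) (pi0 : M1 -> M0),
        von_neumann M0 -> von_neumann M1 -> von_neumann M2 ->
        normal_hom pi1 -> normal_hom pi0 ->
        graph (fun b : M2 => pi0 (pi1 b)) = prod_op (graph pi1) (graph pi0)).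
Proof.
split; [|split].
- move=> H K M N vM vN; split.
  + move=> pi hpi /=; have [rho rN rE] := rep_of_hom vN hpi.
    rewrite (graph_intertwiners rE); apply: intertwiners_quantum_function => // b Nb.
    by rewrite -(set_val_to_set_type Nb) rE; exact: set_val_mem.
  + move=> pi pi' /set_mem hpi /set_mem hpi' gE.
    have [rho rN rE] := rep_of_hom vN hpi.
    have [rho' rN' rE'] := rep_of_hom vN hpi'.
    rewrite (graph_intertwiners rE) (graph_intertwiners rE') in gE.
    apply/funext => b; apply: set_val_inj; rewrite -rE -rE'.
    apply: bopE => h; apply/eqP; rewrite -subr_eq0; apply/eqP.
    apply: (intertwiners_nondegenerate vN rN) => v vI.
    have Nb := set_val_mem b.
    have vI' : intertwiners N rho' v by rewrite -gE.
    by rewrite bop_appB -!bop_compE -vI// -vI'// subrr.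
  + move=> V qV; have [rho [rN rM VE]] := qfun_rep vN vM qV.
    have [pi hpi piE] := hom_of_rep rN rM.
    by exists pi => //; rewrite (graph_intertwiners piE).
- by move=> H M _; rewrite commutant_intertwiners; apply: graph_intertwiners.
- move=> H0 H1 H2 M0 M1 M2 pi1 pi0 v0 v1 v2 h1 h0.
  have [rho1 rN1 rE1] := rep_of_hom v2 h1.
  have [rho0 rN0 rE0] := rep_of_hom v1 h0.
  have rM1 b : M2 b -> M1 (rho1 b).
    by move=> Mb; rewrite -(set_val_to_set_type Mb) rE1; exact: set_val_mem.
  rewrite (graph_intertwiners rE1) (graph_intertwiners rE0).
  rewrite (@graph_intertwiners _ _ _ _ _ _ (fun b => rho0 (rho1 b))); last first.
    by move=> b; rewrite rE1 rE0.
  apply/seteqP; split=> [u uI|].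
    apply/prod_opP => f nf fVV.
    have /prod_opP/(_ _ (normal_funl u nf)) := intertwiners_one v1 rN0.
    rewrite bop_comp1; apply=> v w /adjoint_setE Vv Vw; rewrite -bop_compA.
    apply: fVV => // b Mb.
    have := intertwiners_adj v1 rN0 Vv (rM1 _ Mb); rewrite adjK => e.
    by rewrite -bop_compA uI// !bop_compA e.
  apply: prod_op_sub; [exact: intertwiners_subspace|exact: intertwiners_closed|].
  move=> v w Vv Vw b Mb; rewrite -bop_compA Vv// bop_compA Vw ?bop_compA//.
  exact: rM1.
Qed.
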